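(* Let $\nu$ be a probability measure with $\nu([0,M])=1$, $\nu\ne\delta_M$ and $\nu([M-\varepsilon,M])>0$ for all $\varepsilon>0$, for some $M>0$; let $\mathbf{w}$ be i.i.d. with law $\nu$ (law $\mu$), and let $0<\kappa<1$. Then for $\mu$-almost every $\mathbf{w}$ and every $k\in\mathbb{Z}$, $$\mathbb{P}^{\mathbf{w}}_k\Big(\lim_{n\to\infty}X^{(\kappa)}_n=+\infty\Big)+\mathbb{P}^{\mathbf{w}}_k\Big(\lim_{n\to\infty}X^{(\kappa)}_n=-\infty\Big)=1,$$ and $\mathbb{P}^{\mathbf{w}}_k$-almost surely, on the event $\{X^{(\kappa)}_n\to+\infty\}$ one has $X^{(\kappa)}_n/n\to v$, and on the event $\{X^{(\kappa)}_n\to-\infty\}$ one has $X^{(\kappa)}_n/n\to-v$, where $v=1/\mathbb{E}_\mu[S]\in(0,\infty)$.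
   Context: The matrix $A$ has $a_{i,i}=\mathrm{w}_i$, $a_{i,i\pm1}=1$, other entries $0$; its combinatorial spectral radius is a.s. $\lambda=2+M$. For $i\in\mathbb{Z}$, $\beta_i$ and $\alpha_i$ are given by the convergent continued fractions $\beta_i=1/(\lambda-\mathrm{w}_i-1/(\lambda-\mathrm{w}_{i-1}-1/(\lambda-\mathrm{w}_{i-2}-\cdots)))$ and $\alpha_i=1/(\lambda-\mathrm{w}_i-1/(\lambda-\mathrm{w}_{i+1}-\cdots))$ (equivalently, $\beta_i$, resp. $\alpha_i$, is $\frac1\lambda$ times the generating function at $z=1/\lambda$ of weighted paths from $i$ to $i$ with steps in $\{-1,0,1\}$ staying $\le i$, resp. $\ge i$, a path's weight being the product of the matrix entries along it). Set $\psi^\pm_0=1$, $\psi^+_i=\beta_{-1}\cdots\beta_i$ ($i<0$), $\psi^+_i=(\beta_0\cdots\beta_{i-1})^{-1}$ ($i>0$), $\psi^-_i=(\alpha_0\cdots\alpha_{i+1})^{-1}$ ($i<0$), $\psi^-_i=\alpha_1\cdots\alpha_i$ ($i>0$); these are the two extremal normalized positive $\lambda$-eigenvectors of $A$. $\psi^{(\kappa)}=\kappa\psi^++(1-\kappa)\psi^-$ and $X^{(\kappa)}$ is the Markov chain with $p_{i,i+1}=\psi^{(\kappa)}_{i+1}/(\lambda\psi^{(\kappa)}_i)$, $p_{i,i}=\mathrm{w}_i/\lambda$, $p_{i,i-1}=\psi^{(\kappa)}_{i-1}/(\lambda\psi^{(\kappa)}_i)$; $\mathbb{P}^{\mathbf{w}}_k$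 is its law from $k$. $S=\lambda\beta_0+\lambda\sum_{i\ge1}\beta_0\beta_{-1}^2\cdots\beta_{-i}^2$. *)

(* Defs.v *)
From HB Require Import structures.
From mathcomp Require Export all_boot all_order all_algebra.
From mathcomp Require Export all_classical all_reals all_analysis.
Export Order.TTheory GRing.Theory Num.Theory.
Export numFieldNormedType.Exports.

Set Implicit Arguments.
Unset Strict Implicit.
Unset Printing Implicit Defensive.

Local Open Scope classical_set_scope.
Local Open Scope ring_scope.

Section Environment.
Variables (R : realType) (M : R) (w : int -> R).

(* Value of the combinatorial spectral radius of the tridiagonal matrix A
   (diagonal entries w i, off-diagonal entries 1), almost surely. *)
Definition lambda : R := 2 + M.

(* beta_trunc n i = 1/(lambda - w_i - 1/(lambda - w_{i-1} - ... -
   1/(lambda - w_{i-n+1}))), the continued fraction cut after n levels. *)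
Fixpoint beta_trunc (n : nat) (i : int) : R :=
  if n is n'.+1 then (lambda - w i - beta_trunc n' (i - 1))^-1 else 0.

Fixpoint alpha_trunc (n : nat) (i : int) : R :=
  if n is n'.+1 then (lambda - w i - alpha_trunc n' (i + 1))^-1 else 0.

Definition beta (i : int) : R := limn (fun n => beta_trunc n i).
Definition alpha (i : int) : R := limn (fun n => alpha_trunc n i).

(* Negz n is the integer -(n+1). *)
Definition psi_plus (i : int) : R :=
  match i with
  | Posz n => (\prod_(j < n) beta j%:Z)^-1
  | Negz n => \prod_(j < n.+1) beta (- (j.+1)%:Z)
  end.

Definition psi_minus (i : int) : R :=
  match i with
  | Posz n => \prod_(j < n) alpha (j.+1)%:Z
  | Negz n => (\prod_(j < n.+1) alpha (- j%:Z))^-1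
  end.

Definition psi (kappa : R) (i : int) : R :=
  kappa * psi_plus i + (1 - kappa) * psi_minus i.

Definition trans (kappa : R) (i j : int) : R :=
  if j == i + 1 then psi kappa (i + 1) / (lambda * psi kappa i)
  else if j == i then w i / lambda
  else if j == i - 1 then psi kappa (i - 1) / (lambda * psi kappa i)
  else 0.

(* The random variable S, extended-real valued so that finiteness of its mean has content. *)
Definition speed_sum : \bar R :=
  ((lambda * beta 0)%:E +
   lambda%:E * \sum_(1 <= i <oo)
     (beta 0 * \prod_(1 <= j < i.+1) beta (- j%:Z) ^+ 2)%:E)%E.

End Environment.

Definition mutually_independent (d : measure_display) (T : measurableType d)
    (R : realType) (P : probability T R) (I : eqType)
    (Y : I -> {RV P >-> R}) : Prop :=
  forall (s : seq I) (A : I -> set R), uniq s ->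
    (forall i, measurable (A i)) ->
    fine (P [set t | forall i, i \in s -> A i (Y i t)]) =
    \prod_(i <- s) fine (P (Y i @^-1` A i)).

Definition iid_with_law (d : measure_display) (T : measurableType d)
    (R : realType) (P : probability T R) (nu : probability R R) (I : eqType)
    (Y : I -> {RV P >-> R}) : Prop :=
  mutually_independent Y /\
  forall i (A : set R), measurable A -> distribution P (Y i) A = nu A.

(* The Markov property is written multiplicatively over all histories
   x 0, ..., x n, with no conditioning on null events. *)
Definition markov_chain (d : measure_display) (T : measurableType d)
    (R : realType) (Q : probability T R) (p : int -> int -> R) (k : int)
    (X : nat -> T -> int) : Prop :=
  [/\ forall n i, measurable (X n @^-1` [set i]),
      Q (X 0%N @^-1` [set k]) = 1%E &
      forall (n : nat) (x : nat -> int),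
        Q [set t | forall m, (m <= n.+1)%N -> X m t = x m] =
        (Q [set t | forall m, (m <= n)%N -> X m t = x m]
          * (p (x n) (x n.+1))%:E)%E].

Definition to_pinfty (R : realType) (T : Type) (X : nat -> T -> int) : set T :=
  [set t | ((X n t)%:~R : R) @[n --> \oo] --> +oo].

Definition to_ninfty (R : realType) (T : Type) (X : nat -> T -> int) : set T :=
  [set t | ((X n t)%:~R : R) @[n --> \oo] --> -oo].

(* Main.v *)
From HB Require Import structures.
From Stdlib Require Import PeanoNat.
From mathcomp Require Import ring lra zify.
Require Import Defs.
From mathcomp Require Import measurable_realfun simple_functions.

Set Implicit Arguments.
Unset Strict Implicit.
Unset Printing Implicit Defensive.

Local Open Scope classical_set_scope.
Local Open Scope ring_scope.

(* Under the [h]-transform by [kappa psi^+ / psi] the chain becomes the one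
   with [kappa = 1], which drifts to the right; symmetrically for [psi^-]. No
   measure for the transformed chain is built: every estimate is an integral
   against the given law, weighted by [h (X n)], and [h >= kappa] on [i >= 0].

   Transience: the Green function of [A] at [lambda] with pole [i], divided by
   [psi], is a nonnegative superharmonic function whose defect sits at [i], so
   the expected number of visits to [i] is finite. Unit steps then force the
   chain to one of the two infinities.

   Speed: let [f] have increments [f (i + 1) - f i = S_i], the quenched mean
   crossing time of the edge [i, i + 1] for the chain with [kappa = 1]. Then
   [f (X n) - n] is a martingale for the transformed chain; its sixth moment is
   at most [143 n^3 B^3] with [B] a bound on the squared increments seen up to
   time [n], which grows slowly because [S_i] has all moments. Hence
   [f (X n) / n --> 1] on [X --> +oo], and [f i / i --> E S] gives the speed.

   Environment: with [b_i = 1 / (1 + M - w_i) >= beta_i] and [E b < 1], the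
   recursion [u_{i+1} = 1 + beta_i^2 u_i] for [S_i = lambda beta_i u_i] bounds
   all moments of [u], and cutting the continued fractions at one site bounds
   the correlation of [S_0] and [S_n] by [C n^2 (E b)^n]. A second moment
   argument along squares yields [f i / i --> E S]. The case [X --> -oo]
   follows by reflecting the environment. *)

(** * Continued fractions and eigenvectors *)

(** The exponents are chosen backwards from the last step. Convergence along all [n], with no
    subsequence, follows once the moment divided by [n ^ 6] is summable; [n ^ 3 B ^ 3] allows this
    when [B ^ 3 = O(n)], that is when sixth powers of increments grow at most linearly in the site.
    By a square root this needs twelfth powers bounded by [C (1 + |i|) ^ 2], which uniform twelfth
    moments give because [(1 + |i|) ^ (-2)] is summable.

    The obstacle in the law of large numbers is that [S_i] depends on the whole environment to the
    left of [i]. The error of a cut is at most a function of the sites beyond the cut, with mean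
    [(E b) ^ n], times a function of the sites before it, so it can be integrated by independence. A
    one-sided comparison suffices, since a variance only needs an upper bound on correlations.

    The assumption that [nu] is not the Dirac mass at [M] enters through [E b < 1]: [b <= 1], with
    equality only at [w = M].

    Integrals are taken of nonnegative functions, and almost sure statements come from monotone
    partial sums with bounded mean; no integrability has to be carried along. *)

Section ContinuedFractions.
Variables (R : realType) (M : R) (w : int -> R).
Hypothesis w_itv : forall i, 0 <= w i <= M.

Let lam := lambda M.
Let bt n i := beta_trunc M w n i.
Let bet i := beta M w i.

Lemma beta_trunc_itv n i : 0 <= bt n i <= 1.
Proof.
rewrite /bt; elim: n i => [|n IHn] i /=; first by rewrite lexx ler01.
have /andP[h0 h1] := IHn (i - 1); have /andP[v0 v1] := w_itv i.
have d1 : 1 <= lambda M - w i - beta_trunc M w n (i - 1) by rewrite /lambda; lra.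
by rewrite invr_ge0 (le_trans ler01 d1)/= invf_le1// (lt_le_trans ltr01 d1).
Qed.

Lemma beta_trunc_denom_ge1 n i : 1 <= lam - w i - bt n (i - 1).
Proof.
have /andP[h0 h1] := beta_trunc_itv n (i - 1); have /andP[v0 v1] := w_itv i.
by rewrite /lam /lambda; lra.
Qed.

Lemma beta_trunc_nd i : nondecreasing_seq (bt^~ i).
Proof.
apply/nondecreasing_seqP => n; elim: n i => [|n IHn] i.
  by have /andP[] := beta_trunc_itv 1 i.
have := IHn (i - 1); have := beta_trunc_denom_ge1 n i.
have := beta_trunc_denom_ge1 n.+1 i.
rewrite /bt /lam; set u := beta_trunc _ _ n (i - 1).
set v := beta_trunc _ _ n.+1 (i - 1) => dv du uv.
have -> : beta_trunc M w n.+2 i = (lambda M - w i - v)^-1 by [].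
have -> : beta_trunc M w n.+1 i = (lambda M - w i - u)^-1 by [].
by rewrite lef_pV2 ?posrE; lra.
Qed.

Lemma beta_trunc_cvg i : bt n i @[n --> \oo] --> bet i.
Proof.
apply: nondecreasing_is_cvgn; first exact: beta_trunc_nd.
by exists 1 => _ [n _ <-]; have /andP[] := beta_trunc_itv n i.
Qed.

Lemma beta_trunc_le n i : bt n i <= bet i.
Proof.
apply: nondecreasing_cvgn_le; first exact: beta_trunc_nd.
by apply: cvgP; exact: beta_trunc_cvg.
Qed.

Lemma beta_ge0 i : 0 <= bet i.
Proof. exact: (le_trans _ (beta_trunc_le 0 i)). Qed.

Lemma beta_le1 i : bet i <= 1.
Proof.
apply: limr_le; first by apply: cvgP; exact: beta_trunc_cvg.
by apply: nearW => n; have /andP[] := beta_trunc_itv n i.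
Qed.

Lemma beta_denom_ge1 i : 1 <= lam - w i - bet (i - 1).
Proof.
have := beta_le1 (i - 1); have /andP[v0 v1] := w_itv i.
by rewrite /lam /lambda; lra.
Qed.

Lemma beta_rec i : bet i = (lam - w i - bet (i - 1))^-1.
Proof.
rewrite {1}/bet /beta; apply/cvg_lim => //.
rewrite -(cvg_shiftS _); apply: cvgV.
  by rewrite gt_eqF// (lt_le_trans ltr01 (beta_denom_ge1 i)).
by apply: cvgB; [exact: cvg_cst|exact: beta_trunc_cvg].
Qed.

Lemma beta_gt0 i : 0 < bet i.
Proof. by rewrite beta_rec invr_gt0 (lt_le_trans ltr01 (beta_denom_ge1 i)). Qed.

Lemma beta_le_inv i : bet i <= (1 + M - w i)^-1.
Proof.
have := beta_le1 (i - 1); have /andP[v0 v1] := w_itv i.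
move=> h; rewrite beta_rec /lam /lambda.
by rewrite lef_pV2 ?posrE; lra.
Qed.

(** If [bet i = 1] its denominator is [1], which leaves no slack in [w i <= M] and
    [bet (i - 1) <= 1]. Iterated to the left, this is what later excludes [beta i = 1]. *)
Lemma beta_eq1 i : bet i = 1 -> bet (i - 1) = 1.
Proof.
move=> bi1; apply/eqP; rewrite eq_le beta_le1/=.
have := beta_rec i; rewrite bi1 => /(congr1 GRing.inv); rewrite invr1 invrK.
by have /andP[v0 v1] := w_itv i; rewrite /lam /lambda => h; lra.
Qed.

Lemma beta_inv i : (bet i)^-1 = lam - w i - bet (i - 1).
Proof. by rewrite beta_rec invrK. Qed.

Lemma psi_plus_gt0 i : 0 < psi_plus M w i.
Proof.
by case: i => n /=; rewrite ?invr_gt0; apply: prodr_gt0 => j _; exact: beta_gt0.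
Qed.

Lemma psi_plusS i : psi_plus M w (i + 1) = psi_plus M w i / bet i.
Proof.
case: i => n.
  have -> : n%:Z + 1 = n.+1%:Z by lia.
  by rewrite /psi_plus big_ord_recr/= invfM.
have bn0 j : beta M w j != 0 by rewrite gt_eqF// beta_gt0.
case: n => [|n].
  have -> : Negz 0 + 1 = 0 by lia.
  by rewrite /= big_ord0 big_ord_recl big_ord0 mulr1 invr1 /bet divff.
have -> : Negz n.+1 + 1 = Negz n by lia.
by rewrite /= [in RHS]big_ord_recr/= /bet NegzE mulfK.
Qed.

(** The recursion of [beta] is the Riccati form of the eigenvector equation, [bet i] being the ratio
    of the values of [psi_plus] at [i] and [i + 1]. *)
Lemma psi_plus_eigen i :
  psi_plus M w (i + 1) + w i * psi_plus M w i + psi_plus M w (i - 1)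
  = lam * psi_plus M w i.
Proof.
rewrite psi_plusS beta_inv.
have := psi_plusS (i - 1); rewrite subrK => ->.
by field; rewrite gt_eqF// beta_gt0.
Qed.

(** Together with [psi_minus_le1] this shows that [psi_plus] dominates [psi_minus] on the right
    half-line, the source of the lower bound [kappa] on the h-transform there. *)
Lemma psi_plus_ge1 (n : nat) : 1 <= psi_plus M w n.
Proof.
rewrite /= invf_ge1; last by apply: prodr_gt0 => j _; exact: beta_gt0.
by apply: prodr_ile1 => j _; rewrite beta_ge0 beta_le1.
Qed.

Lemma psi_plusN_le1 (n : nat) : psi_plus M w (- n%:Z) <= 1.
Proof.
case: n => [|n]; first by rewrite oppr0 /= big_ord0 invr1.
rewrite -NegzE /=.
by apply: prodr_ile1 => j _; rewrite beta_ge0 beta_le1.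
Qed.

End ContinuedFractions.

Section Reflection.
Variables (R : realType) (M : R).
Implicit Types w : int -> R.

Definition reflect_env w : int -> R := fun i => w (- i).

Lemma reflect_envK w : reflect_env (reflect_env w) = w.
Proof. by apply/funext => i; rewrite /reflect_env opprK. Qed.

Lemma alpha_reflect w i : alpha M w i = beta M (reflect_env w) (- i).
Proof.
rewrite /alpha /beta.
suff -> : (fun n => alpha_trunc M w n i)
        = (fun n => beta_trunc M (reflect_env w) n (- i)) by [].
apply/funext => n; elim: n i => //= n IHn i.
by rewrite IHn /reflect_env opprK opprD.
Qed.

Lemma psi_minus_reflect w i : psi_minus M w i = psi_plus M (reflect_env w) (- i).
Proof.
case: i => n.
  case: n => [|n]; first by rewrite oppr0 /= !big_ord0 invr1.
  by rewrite -NegzE /=; apply: eq_bigr => j _; rewrite alpha_reflect.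
rewrite NegzE opprK /=; congr (_^-1).
by apply: eq_bigr => j _; rewrite alpha_reflect opprK.
Qed.

(** Reflecting the environment exchanges the two extremal eigenvectors, hence [kappa] and
    [1 - kappa]; the left end is thereby reduced to the right end. *)
Lemma psi_reflect w kappa i :
  psi M (reflect_env w) (1 - kappa) (- i) = psi M w kappa i.
Proof.
rewrite /psi psi_minus_reflect psi_minus_reflect reflect_envK opprK.
by rewrite opprB addrC [1 + _]addrC subrK.
Qed.

Lemma trans_reflect w kappa i j :
  trans M (reflect_env w) (1 - kappa) (- i) (- j) = trans M w kappa i j.
Proof.
have psiN k : psi M (reflect_env w) (1 - kappa) k = psi M w kappa (- k).
  by rewrite -{1}[k]opprK psi_reflect.
rewrite /trans !psiN {1}/reflect_env !opprK !opprD !opprK.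
have -> : (- j == - i + 1) = (j == i - 1) by lia.
have -> : (- j == - i) = (j == i) by lia.
have -> : (- j == - i - 1) = (j == i + 1) by lia.
case: (eqVneq j (i - 1)) => [->|].
  have -> : (i - 1 == i + 1) = false by lia.
  by have -> : (i - 1 == i) = false by lia.
case: (eqVneq j i) => [->|] //.
by have -> : (i == i + 1) = false by lia.
Qed.

End Reflection.

Section Transitions.
Variables (R : realType) (M : R).
Implicit Types (w : int -> R) (kappa : R).

Lemma trans_right w kappa i :
  trans M w kappa i (i + 1) = psi M w kappa (i + 1) / (lambda M * psi M w kappa i).
Proof. by rewrite /trans eqxx. Qed.

Lemma trans_stay w kappa i : trans M w kappa i i = w i / lambda M.
Proof. by rewrite /trans eqxx; have -> : (i == i + 1) = false by lia. Qed.

Lemma trans_left w kappa i :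
  trans M w kappa i (i - 1) = psi M w kappa (i - 1) / (lambda M * psi M w kappa i).
Proof.
rewrite /trans eqxx; have -> : (i - 1 == i + 1) = false by lia.
by have -> : (i - 1 == i) = false by lia.
Qed.

End Transitions.

Section Eigenvectors.
Variables (R : realType) (M : R) (w : int -> R).
Hypothesis w_itv : forall i, 0 <= w i <= M.

Let wr_itv i : 0 <= reflect_env w i <= M. Proof. exact: w_itv. Qed.

Lemma psi_minus_gt0 i : 0 < psi_minus M w i.
Proof. by rewrite psi_minus_reflect psi_plus_gt0. Qed.

Lemma psi_minusS i : psi_minus M w (i + 1) = alpha M w (i + 1) * psi_minus M w i.
Proof.
rewrite !psi_minus_reflect alpha_reflect.
have -> : - i = - (i + 1) + 1 by lia.
by rewrite psi_plusS// mulrC divfK// gt_eqF// beta_gt0.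
Qed.

Lemma psi_minus_eigen i :
  psi_minus M w (i + 1) + w i * psi_minus M w i + psi_minus M w (i - 1)
  = lambda M * psi_minus M w i.
Proof.
rewrite !psi_minus_reflect -psi_plus_eigen// /reflect_env opprK opprD opprB.
by rewrite addrC addrAC addrA; congr (_ + _ + _); congr (psi_plus _ _ _); lia.
Qed.

Lemma alpha_itv i : 0 < alpha M w i <= 1.
Proof. by rewrite alpha_reflect beta_gt0//= beta_le1. Qed.

Lemma psi_minus_le1 (n : nat) : psi_minus M w n <= 1.
Proof. by rewrite psi_minus_reflect psi_plusN_le1. Qed.

Variable kappa : R.
Hypotheses (kappa_gt0 : 0 < kappa) (kappa_lt1 : kappa < 1).

Lemma psi_gt0 i : 0 < psi M w kappa i.
Proof.
by rewrite addr_gt0// mulr_gt0 ?subr_gt0 ?psi_plus_gt0 ?psi_minus_gt0.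
Qed.

Lemma lambda_gt0 : 0 < lambda M.
Proof. by have /andP[h0 h1] := w_itv 0; rewrite /lambda; lra. Qed.

Lemma trans_ge0 i j : 0 <= trans M w kappa i j.
Proof.
have l0 := ltW lambda_gt0; have p0 k := ltW (psi_gt0 k).
rewrite /trans; case: ifP => _; first by rewrite divr_ge0 ?mulr_ge0.
case: ifP => _; first by rewrite divr_ge0//; have /andP[] := w_itv i.
by case: ifP => _ //; rewrite divr_ge0 ?mulr_ge0.
Qed.

End Eigenvectors.

(** * Path space of the environment *)

Section PathSpace.
Variable R : realType.

Definition cylinder (s : seq int) (A : int -> set R) : set (int -> R) :=
  [set x | forall i, i \in s -> A i (x i)].

Definition cylinders : set (set (int -> R)) :=
  [set C | exists s A, [/\ uniq s, forall i, measurable (A i) & C = cylinder s A]].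

Definition env : Type := g_sigma_algebraType cylinders.

HB.instance Definition _ := Measurable.on env.

Lemma cylinders_setI : setI_closed cylinders.
Proof.
move=> _ _ [s [A [us mA ->]]] [s' [A' [us' mA' ->]]].
exists (undup (s ++ s')).
exists (fun i => (if i \in s then A i else setT) `&` (if i \in s' then A' i else setT)).
split; first exact: undup_uniq.
  by move=> i; apply: measurableI; case: ifP.
apply/seteqP; split=> x /=.
  move=> [xs xs'] i _; split; case: ifP => // ii; [exact: xs|exact: xs'].
move=> h; split=> i ii; have := h i; rewrite mem_undup mem_cat ii ?orbT => /(_ isT).
  by case.
by case.
Qed.

Lemma measurable_env_coord i : measurable_fun [set: env] (fun x : env => x i).
Proof.
move=> _ A mA; rewrite setTI; apply: sub_sigma_algebra.
exists [:: i], (fun=> A); split=> //.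
apply/seteqP; split=> x /=; first by move=> Ax j; rewrite inE => /eqP ->.
by apply; rewrite inE.
Qed.

Lemma measurable_env d (T : measurableType d) (Y : T -> env) :
  (forall i, measurable_fun setT (fun t => Y t i)) -> measurable_fun setT Y.
Proof.
move=> mY; apply: (@measurability _ _ T env setT Y cylinders) => //.
move=> _ [_ [s [A [us mA ->]]] <-].
have -> : [set: T] `&` Y @^-1` cylinder s A =
    \big[setI/setT]_(i <- s) ((fun t => Y t i) @^-1` A i).
  rewrite setTI {us}; elim: s => [|j s IHs].
    by rewrite big_nil; apply/seteqP; split=> x.
  rewrite big_cons -IHs; apply/seteqP; split=> x /=.
    by move=> h; split=> [|i ii]; apply: h; rewrite inE ?eqxx ?ii ?orbT.
  by move=> [h0 h] i; rewrite inE => /orP[/eqP->//|]; exact: h.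
elim: s {us} => [|j s IHs]; first by rewrite big_nil.
by rewrite big_cons; apply: measurableI => //; rewrite -[X in measurable X]setTI; apply: mY.
Qed.

Variable nu : probability R R.

(** The law of [Y] is the product of copies of [nu], prescribed on cylinders only. No infinite
    product measure is constructed: the measure on path space will be the image of [mu]. With
    [Y := id] the predicate speaks about that measure itself. *)
Definition iid_env d (T : measurableType d) (P : probability T R) (Y : T -> env) :=
  measurable_fun setT Y /\
  forall s A, uniq s -> (forall i, measurable (A i)) ->
    P (Y @^-1` cylinder s A) = (\prod_(i <- s) fine (nu (A i)))%:E.

(** Cylinders form a pi-system generating the sigma-algebra, so they determine the law. Shifts,
    reflections and gluings of the environment are all handled through this equality of laws. *)
Lemma iid_env_integral d1 (T1 : measurableType d1) (P1 : probability T1 R)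
    (Y1 : T1 -> env) d2 (T2 : measurableType d2) (P2 : probability T2 R)
    (Y2 : T2 -> env) (F : env -> \bar R) :
  iid_env P1 Y1 -> iid_env P2 Y2 -> measurable_fun setT F ->
  (forall x, 0 <= F x)%E ->
  (\int[P1]_t F (Y1 t) = \int[P2]_t F (Y2 t))%E.
Proof.
move=> [m1 h1] [m2 h2] mF F0.
pose X1 : {mfun T1 >-> env} := HB.pack Y1 (isMeasurableFun.Build _ _ _ _ _ m1).
pose X2 : {mfun T2 >-> env} := HB.pack Y2 (isMeasurableFun.Build _ _ _ _ _ m2).
transitivity (\int[distribution P1 X1]_x F x)%E.
  by rewrite (ge0_integral_distribution X1).
rewrite -(ge0_integral_distribution X2)//.
apply: eq_measure_integral => A mA _.
apply: (@measure_unique _ R env cylinders (fun=> setT) _ _ _ _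
  (distribution P1 X1) (distribution P2 X2)) => //.
- exact: cylinders_setI.
- move=> _; exists [::], (fun=> setT); split=> //.
  by apply/seteqP; split.
- by rewrite bigcup_const//; exists 0%N.
- by move=> _ [s [B [us mB ->]]]; rewrite [LHS]h1// [RHS]h2.
- by move=> _; rewrite [ltLHS]probability_setT ltry.
Qed.

Lemma iid_env_inj d (T : measurableType d) (P : probability T R) (Y : T -> env)
    (sigma tau : int -> int) : cancel sigma tau -> iid_env P Y ->
  iid_env P (fun t => (fun i => Y t (sigma i)) : env).
Proof.
move=> sK [mY hY]; split.
  apply: measurable_env => i.
  by apply: (measurableT_comp (measurable_env_coord (sigma i))).
move=> s A us mA.
have := hY (map sigma s) (A \o tau).
rewrite map_inj_uniq; last exact: can_inj sK.
rewrite us big_map => /(_ isT (fun i => mA _)).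
rewrite (eq_bigr (fun i => fine (nu (A i)))) => [<-|i _]; last by rewrite /= sK.
congr (P _); apply/seteqP; split=> t h i.
  by move=> /mapP[j js ->] /=; rewrite sK; exact: h.
by move=> ii; have := h (sigma i); rewrite map_f//= sK; exact.
Qed.

(** Resampling of the half-line beyond [m]. Since gluing two independent copies preserves the law,
    independence of the two half-lines becomes Tonelli's theorem on the product space. *)
Definition glue (m : int) (z : env * env) : env :=
  fun i => if (i <= m)%R then z.1 i else z.2 i.

Lemma measurable_glue m : measurable_fun setT (glue m).
Proof.
apply: measurable_env => i; rewrite /glue; case: (i <= m).
  by apply: (measurableT_comp (measurable_env_coord i)); exact: measurable_fst.
by apply: (measurableT_comp (measurable_env_coord i)); exact: measurable_snd.
Qed.

Lemma iid_env_glue m (P : probability env R) : iid_env P id ->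
  iid_env (P \x P)%E (glue m).
Proof.
move=> [_ hP]; split; first exact: measurable_glue.
move=> s A us mA.
pose s1 := [seq i <- s | i <= m]; pose s2 := [seq i <- s | ~~ (i <= m)].
have -> : glue m @^-1` cylinder s A = cylinder s1 A `*` cylinder s2 A.
  apply/seteqP; split=> [z h|z [/= h1 h2]] /=.
    split=> i; rewrite mem_filter => /andP[im ii]; have := h i ii.
      by rewrite /glue im.
    by rewrite /glue (negbTE im).
  move=> i ii; rewrite /glue; case: ifPn => im.
    by apply: h1; rewrite mem_filter im.
  by apply: h2; rewrite mem_filter im.
have mC t : uniq t -> measurable (cylinder t A : set env).
  by move=> ut; apply: sub_sigma_algebra; exists t, A.
transitivity (P (cylinder s1 A) * P (cylinder s2 A))%E.
  by apply: product_measure1E; apply: mC; exact: filter_uniq.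
rewrite [X in (X * _)%E](hP s1)// ?filter_uniq// [X in (_ * X)%E](hP s2)// ?filter_uniq//.
by rewrite -EFinM !big_filter [in RHS](bigID (fun i => i <= m)).
Qed.

Definition depends_on (D : int -> Prop) (F : env -> \bar R) :=
  forall x y : env, (forall i, D i -> x i = y i) -> F x = F y.

Lemma iid_env_indep m (P : probability env R) (F G : env -> \bar R) :
  iid_env P id -> measurable_fun setT F -> measurable_fun setT G ->
  (forall x, 0 <= F x)%E -> (forall x, 0 <= G x)%E ->
  depends_on (fun i => i <= m) F -> depends_on (fun i => m < i) G ->
  (\int[P]_x (F x * G x) = (\int[P]_x F x) * (\int[P]_x G x))%E.
Proof.
move=> hP mF mG F0 G0 dF dG.
have FG0 x : (0 <= F x * G x)%E by exact: mule_ge0.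
have mFG : measurable_fun setT (fun x => F x * G x)%E by exact: emeasurable_funM.
transitivity (\int[(P \x P)%E]_z (F (glue m z) * G (glue m z)))%E.
  exact: (iid_env_integral hP (iid_env_glue m hP) mFG FG0).
transitivity (\int[(P \x P)%E]_z (F z.1 * G z.2))%E.
  apply: eq_integral => z _; congr (_ * _)%E.
    by apply: dF => i im; rewrite /glue im.
  by apply: dG => i im; rewrite /glue leNgt im.
rewrite fubini_tonelli1/=; last 2 first.
- apply: emeasurable_funM; first exact: (measurableT_comp mF measurable_fst).
  exact: (measurableT_comp mG measurable_snd).
- by move=> z; exact: mule_ge0.
rewrite /fubini_F /=.
under eq_integral do rewrite ge0_integralZl//.
by rewrite ge0_integralZr// integral_ge0.
Qed.

End PathSpace.

(** * Green sums, and the error of cutting the continued fractions *)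

Section PartialSums.
Variables (R : realType) (M : R).
Implicit Types (w : int -> R) (L n : nat) (i m : int).

(* [green_sum w L m] is the sum over [i < L] of
   [beta_{m-1}^2 ... beta_{m-i}^2]; multiplied by [lambda * beta_m] it is a
   partial sum of [S] shifted by [m]. *)
Fixpoint green_sum w L m : R :=
  if L is L'.+1 then 1 + beta M w (m - 1) ^+ 2 * green_sum w L' (m - 1) else 0.

(* The analogue of [green_sum] at site [n], with the continued fractions cut
   at site [0]: it only depends on [w 1, ..., w (n - 1)]. *)
Fixpoint green_trunc w n : R :=
  if n is n'.+1 then 1 + beta_trunc M w n' n'%:Z ^+ 2 * green_trunc w n' else 0.

Definition drop_factor w i : R := (1 + M - w i)^-1.

Lemma green_sumE w L m :
  green_sum w L m = \sum_(i < L) \prod_(1 <= j < i.+1) beta M w (m - j%:Z) ^+ 2.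
Proof.
elim: L m => [|L IHL] m; first by rewrite big_ord0.
rewrite /= IHL big_ord_recl/= big_geq// mulr_sumr; congr (_ + _).
apply: eq_bigr => i _ /=; rewrite [RHS]big_nat_recl//= /bump leq0n add1n.
congr (_ * _); apply: eq_bigr => j _.
by have -> : m - 1 - j%:Z = m - j.+1%:Z by lia.
Qed.

Lemma beta_trunc_agree w w' n i :
  (forall j, i - n%:Z < j <= i -> w j = w' j) ->
  beta_trunc M w n i = beta_trunc M w' n i.
Proof.
elim: n i => //= n IHn i ww'; rewrite ww' ?IHn//; last by lia.
by move=> j hj; apply: ww'; lia.
Qed.

Lemma beta_agree w w' i :
  (forall j, j <= i -> w j = w' j) -> beta M w i = beta M w' i.
Proof.
move=> ww'; rewrite /beta.
suff -> : (fun n => beta_trunc M w n i) = (fun n => beta_trunc M w' n i) by [].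
by apply/funext => n; apply: beta_trunc_agree => j /andP[_]; exact: ww'.
Qed.

Lemma green_sum_agree w w' L m :
  (forall j, j < m -> w j = w' j) -> green_sum w L m = green_sum w' L m.
Proof.
elim: L m => //= L IHL m ww'; congr (1 + _ ^+ 2 * _).
  by apply: beta_agree => j jm; apply: ww'; lia.
by apply: IHL => j jm; apply: ww'; lia.
Qed.

Lemma green_trunc_agree w w' n :
  (forall j, 0 < j < n%:Z -> w j = w' j) -> green_trunc w n = green_trunc w' n.
Proof.
elim: n => //= n IHn ww'; congr (1 + _ ^+ 2 * _).
  by apply: beta_trunc_agree => j hj; apply: ww'; lia.
by apply: IHn => j hj; apply: ww'; lia.
Qed.

Lemma beta_shift w k i : beta M (fun j => w (j + k)) i = beta M w (i + k).
Proof.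
rewrite /beta; suff -> : (fun n => beta_trunc M (fun j => w (j + k)) n i)
  = (fun n => beta_trunc M w n (i + k)) by [].
apply/funext => n; elim: n i => //= n IHn i; rewrite IHn.
by have -> : i - 1 + k = i + k - 1 by lia.
Qed.

Lemma green_sum_shift w k L m :
  green_sum (fun j => w (j + k)) L m = green_sum w L (m + k).
Proof.
elim: L m => //= L IHL m; rewrite IHL beta_shift.
by have -> : m - 1 + k = m + k - 1 by lia.
Qed.

Variable w : int -> R.
Hypothesis w_itv : forall i, 0 <= w i <= M.

Lemma beta_sqr_itv i : 0 <= beta M w i ^+ 2 <= 1.
Proof. by rewrite exprn_ge0 ?exprn_ile1// ?beta_ge0 ?beta_le1. Qed.

Lemma green_sum_itv L m : 0 <= green_sum w L m <= L%:R.
Proof.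
elim: L m => [|L IHL] m; first by rewrite /= lexx.
rewrite -natr1 /=; have /andP[h0 h1] := IHL (m - 1); have /andP[b0 b1] := beta_sqr_itv (m - 1).
apply/andP; split; first by apply: addr_ge0 => //; exact: mulr_ge0.
rewrite addrC lerD2r.
by rewrite (le_trans _ h1)// ler_piMl.
Qed.

Lemma green_sum_nd m : nondecreasing_seq (green_sum w ^~ m).
Proof.
apply/nondecreasing_seqP => L; elim: L m => [|L IHL] m.
  by have /andP[] := green_sum_itv 1 m.
rewrite [in X in _ <= X]/= [in X in X <= _]/= lerD2l ler_wpM2l//.
by have /andP[] := beta_sqr_itv (m - 1).
Qed.

Lemma drop_factor_itv i : 0 < drop_factor w i <= 1.
Proof.
have /andP[h0 h1] := w_itv i; rewrite /drop_factor invr_gt0 invf_le1; lra.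
Qed.

Let t n := beta_trunc M w n n%:Z.
Let Z n := \prod_(l < n) drop_factor w l.+1%:Z.

Let Z_ge0 n : 0 <= Z n.
Proof. by apply: prodr_ge0 => l _; have /andP[/ltW] := drop_factor_itv l.+1. Qed.

Let Z_pred n : (0 < n)%N -> Z n = Z n.-1 * drop_factor w n%:Z.
Proof. by case: n => // n _; rewrite /Z big_ord_recr. Qed.

(** The identity [x - y = x y (1/y - 1/x)] turns the recursions of the two fractions into an exact
    recursion for the error: passing to the next site multiplies it by [beta * t], and
    [beta <= drop_factor] while [t <= 1]. The error at site [0] is at most [1]. *)
Lemma beta_sub_trunc_le n : beta M w n%:Z - t n <= Z n.
Proof.
elim: n => [|n IHn]; first by rewrite /Z /t /= big_ord0 subr0 beta_le1.
have /andP[b0 b1] := drop_factor_itv n.+1.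
rewrite /Z big_ord_recr/= -/(Z n).
have tle := beta_trunc_le w_itv n.+1 n.+1.
have ble : beta M w n.+1 <= drop_factor w n.+1 by exact: beta_le_inv.
have bb0 := beta_gt0 w_itv n.+1; have bb1 := beta_le1 w_itv n.+1.
have /andP[t0 t1] := beta_trunc_itv w_itv n.+1 n.+1.
have tpos : 0 < t n.+1.
  by rewrite /t /= invr_gt0 (lt_le_trans ltr01)//; apply: (beta_trunc_denom_ge1 w_itv).
have -> : beta M w n.+1 - t n.+1 =
    beta M w n.+1 * t n.+1 * (beta M w n%:Z - t n).
  have n1 : n.+1%:Z - 1 = n%:Z by lia.
  have e1 := beta_inv w_itv n.+1; rewrite n1 in e1.
  have e2 : (t n.+1)^-1 = lambda M - w n.+1 - t n by rewrite /t /= invrK n1.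
  have -> : beta M w n%:Z - t n = (t n.+1)^-1 - (beta M w n.+1)^-1.
    by rewrite e1 e2; ring.
  by field; rewrite !gt_eqF.
have [d0|d0] := leP 0 (beta M w n%:Z - t n); last first.
  apply: (@le_trans _ _ 0); last by rewrite mulr_ge0// ltW.
  by rewrite mulr_ge0_le0 ?ltW// mulr_gt0.
rewrite mulrC; apply: ler_pM => //; first by rewrite mulr_ge0 ?ltW.
by rewrite (le_trans _ ble)// ler_piMr// ltW.
Qed.

Lemma green_trunc_itv n : 0 <= green_trunc w n <= n%:R.
Proof.
elim: n => [|n /andP[h0 h1]]; first by rewrite /= lexx.
rewrite -natr1 /=; have /andP[t0 t1] := beta_trunc_itv w_itv n n.
apply/andP; split; first by apply: addr_ge0 => //; apply: mulr_ge0 => //; exact: exprn_ge0.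
rewrite addrC lerD2r.
by rewrite (le_trans _ h1)// ler_piMl// exprn_ile1.
Qed.

(** The difference is multiplied by [beta ^ 2 <= drop_factor] at each site and receives a source
    [(beta - t) (beta + t) a], at most [2 n Z n]; the increment [2 n + 1] of [n ^ 2] absorbs it. The
    depth [L + n] makes the recursion end exactly at [green_sum w L 0]. The index [n.-1] appears
    because the sum at [n] involves [beta] only up to site [n - 1]. *)
Lemma green_sum_sub_trunc_le L n :
  green_sum w (L + n) n%:Z - green_trunc w n
    <= Z n.-1 * (green_sum w L 0 + n%:R ^+ 2).
Proof.
have /andP[v0 _] := green_sum_itv L 0.
elim: n => [|n IHn]; first by rewrite addn0 /= /Z big_ord0 expr0n/= addr0 subr0 mul1r.
rewrite addnS /= -/(Z n).
have -> : n.+1%:Z - 1 = n%:Z by lia.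
set v := green_sum w (L + n) n in IHn *; set a := green_trunc w n in IHn *.
set v0' := green_sum w L 0 in IHn v0 *.
have /andP[a0 a1] := green_trunc_itv n; rewrite -/a in a0 a1.
have dZ := beta_sub_trunc_le n.
have tle := beta_trunc_le w_itv n n; have /andP[t0 t1] := beta_trunc_itv w_itv n n.
have bb0 := beta_ge0 w_itv n; have bb1 := beta_le1 w_itv n.
rewrite -/(t n) in tle t0 t1 *; set bn := beta M w n in dZ tle bb0 bb1 *.
have -> : 1 + bn ^+ 2 * v - (1 + t n ^+ 2 * a) =
   bn ^+ 2 * (v - a) + (bn - t n) * ((bn + t n) * a) by ring.
have n0 : 0 <= n%:R :> R by [].
have -> : Z n * (v0' + n.+1%:R ^+ 2) = Z n * (v0' + n%:R ^+ 2) + Z n * (n%:R + n%:R + 1).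
  by rewrite -natr1; ring.
apply: lerD.
  apply: (@le_trans _ _ (bn ^+ 2 * (Z n.-1 * (v0' + n%:R ^+ 2)))).
    by rewrite ler_wpM2l// exprn_ge0.
  rewrite mulrA ler_wpM2r//; first by rewrite addr_ge0// exprn_ge0.
  have bsq : bn ^+ 2 <= bn by rewrite expr2 ler_piMl.
  (* For [n = 0] both [Z n.-1] and [Z n] are the empty product, so [bsq] and [beta_le1] suffice. *)
  have [->|npos] := posnP n.
    by rewrite /Z /= !big_ord0 mulr1 (le_trans bsq).
  rewrite (Z_pred npos) mulrC ler_wpM2l//.
  by rewrite (le_trans bsq)//; exact: beta_le_inv.
have aa : 0 <= (bn + t n) * a by rewrite mulr_ge0// addr_ge0.
apply: (@le_trans _ _ (Z n * ((bn + t n) * a))); first by rewrite ler_wpM2r.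
rewrite ler_wpM2l// (@le_trans _ _ (2 * n%:R))//; last by lra.
by apply: ler_pM => //; [rewrite addr_ge0|lra].
Qed.

(** The leading factor [beta n] restores the factor missing in [Z n.-1]. On the right, [t n],
    [green_trunc w n] and [Z n] involve only sites after [0], and [green_sum w L 0] only sites
    before it: this is the form in which independence applies. *)
Lemma green_compare L n :
  beta M w n%:Z * green_sum w (L + n) n%:Z <=
    t n * green_trunc w n + Z n * (green_sum w L 0 + n%:R ^+ 2 + n%:R).
Proof.
have := green_sum_sub_trunc_le L n; have dZ := beta_sub_trunc_le n.
have /andP[v0 _] := green_sum_itv L 0.
have /andP[a0 a1] := green_trunc_itv n.
have bb0 := beta_ge0 w_itv n; have bb1 := beta_le1 w_itv n.
set Z' := Z n.-1; set v := green_sum _ (L + n) _; set a := green_trunc _ _.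
set vv := green_sum _ _ 0 in v0 * => h.
have -> : beta M w n * v = t n * a + beta M w n * (v - a) + (beta M w n - t n) * a.
  by ring.
rewrite -[X in X <= _]addrA lerD2l [X in _ <= X]mulrDr; apply: lerD.
  apply: (@le_trans _ _ (beta M w n * (Z' * (vv + n%:R ^+ 2)))); first by rewrite ler_wpM2l.
  rewrite mulrA ler_wpM2r//; first by rewrite addr_ge0// exprn_ge0.
  rewrite /Z'; have [->|npos] := posnP n; first by rewrite /Z /= !big_ord0 mulr1 beta_le1.
  rewrite (Z_pred npos) mulrC ler_wpM2l//.
  exact: beta_le_inv.
by apply: (@le_trans _ _ (Z n * a)); [rewrite ler_wpM2r|rewrite ler_wpM2l].
Qed.

End PartialSums.

(** * Moments *)

Section NonnegativeIntegrals.
Context d (T : measurableType d) (R : realType) (P : {measure set T -> \bar R}).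
Implicit Types f g : T -> R.

Lemma integral_EFin_le f g : measurable_fun setT f -> measurable_fun setT g ->
  (forall x, 0 <= f x <= g x) -> (\int[P]_x (f x)%:E <= \int[P]_x (g x)%:E)%E.
Proof.
move=> mf mg fg; apply: ge0_le_integral => //.
- by move=> x _; rewrite lee_fin; have /andP[] := fg x.
- exact/measurable_EFinP.
- exact/measurable_EFinP.
- by move=> x _; rewrite lee_fin; have /andP[] := fg x.
Qed.

Lemma integral_EFinD f g : measurable_fun setT f -> measurable_fun setT g ->
  (forall x, 0 <= f x) -> (forall x, 0 <= g x) ->
  (\int[P]_x (f x + g x)%:E = \int[P]_x (f x)%:E + \int[P]_x (g x)%:E)%E.
Proof.
move=> mf mg f0 g0; under eq_integral do rewrite EFinD.
apply: ge0_integralD => //; by [move=> x _; rewrite lee_fin|exact/measurable_EFinP].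
Qed.

Lemma integral_EFinZ k f : measurable_fun setT f -> (forall x, 0 <= f x) -> 0 <= k ->
  (\int[P]_x (k * f x)%:E = k%:E * \int[P]_x (f x)%:E)%E.
Proof.
move=> mf f0 k0; under eq_integral do rewrite EFinM.
apply: ge0_integralZl_EFin => //; by [move=> x _; rewrite lee_fin|exact/measurable_EFinP].
Qed.

Lemma integral_EFin_sum (I : eqType) (s : seq I) (f : I -> T -> R) :
  (forall i, measurable_fun setT (f i)) -> (forall i x, 0 <= f i x) ->
  (\int[P]_x (\sum_(i <- s) f i x)%:E = \sum_(i <- s) \int[P]_x (f i x)%:E)%E.
Proof.
move=> mf f0; under eq_integral do rewrite -sumEFin.
apply: ge0_integral_sum => // i; by [move=> x _; rewrite lee_fin|exact/measurable_EFinP].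
Qed.

Variables (g : nat -> T -> R).
Hypotheses (mg : forall n, measurable_fun setT (g n)) (g0 : forall n x, 0 <= g n x)
  (nd_g : forall x, nondecreasing_seq (g ^~ x)).

Lemma integral_limn_le (C : \bar R) :
  (forall n, (\int[P]_x (g n x)%:E <= C)%E) ->
  (\int[P]_x limn (fun n => (g n x)%:E) <= C)%E.
Proof.
move=> gC; rewrite monotone_convergence//.
- apply: lime_le; last exact: nearW.
  apply: ereal_nondecreasing_is_cvgn => m n mn.
  by apply: integral_EFin_le => // x; rewrite g0 nd_g.
- by move=> n; exact/measurable_EFinP.
- by move=> n x _; rewrite lee_fin.
- by move=> x _ m n mn; rewrite lee_fin nd_g.
Qed.

Lemma measurable_limn_nd : measurable_fun setT (fun x => limn (fun n => (g n x)%:E)).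
Proof.
apply: (emeasurable_fun_cvg (fun n x => (g n x)%:E)).
  by move=> n; exact/measurable_EFinP.
move=> x _; apply: ereal_nondecreasing_is_cvgn => m n mn.
by rewrite lee_fin nd_g.
Qed.

Lemma le_limn_nd x n : ((g n x)%:E <= limn (fun n => (g n x)%:E))%E.
Proof.
have nd : nondecreasing_seq (fun n => (g n x)%:E).
  by move=> i j ij; rewrite lee_fin nd_g.
rewrite (cvg_lim _ (ereal_nondecreasing_cvgn nd))//.
by apply: ereal_sup_ubound; exists n.
Qed.

(** The limit has finite mean by monotone convergence, hence is finite almost everywhere. This
    replaces Borel-Cantelli throughout: applied to partial sums of nonnegative terms, it makes the
    terms tend to zero. *)
Lemma ae_bounded_nd (C : R) : (forall n, (\int[P]_x (g n x)%:E <= C%:E)%E) ->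
  \forall x \ae P, exists B, forall n, g n x <= B.
Proof.
move=> gC; pose G x := limn (fun n => (g n x)%:E).
have G0 x : (0 <= G x)%E.
  by rewrite (le_trans _ (le_limn_nd x 0))// lee_fin.
have iG : P.-integrable setT G.
  apply/integrableP; split; first exact: measurable_limn_nd.
  under eq_integral do rewrite gee0_abs//.
  by rewrite (le_lt_trans (integral_limn_le gC))// ltry.
have := integrable_ae measurableT iG; apply: filterS => x /(_ I) Gx.
by exists (fine (G x)) => n; rewrite -lee_fin fineK// le_limn_nd.
Qed.

End NonnegativeIntegrals.

Lemma integral_prob_cst d (T : measurableType d) (R : realType)
    (P : probability T R) (k : R) : (\int[P]_x k%:E = k%:E)%E.
Proof. by rewrite integral_cst//= probability_setT mule1. Qed.

Section PowerBounds.
Variable R : realType.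

Lemma expr1D_le_linear (t : R) p : 0 <= t <= 1 -> (1 + t) ^+ p <= 1 + 2 ^+ p * t.
Proof.
move=> /andP[t0 t1].
suff: (1 + t) ^+ p <= 1 + (2 ^+ p - 1) * t by move=> /le_trans; apply; nra.
elim: p => [|p IHp]; first by rewrite !expr0; lra.
rewrite !exprS.
have p1 : 1 <= 2 ^+ p :> R by rewrite exprn_ege1//; lra.
apply: (@le_trans _ _ ((1 + t) * (1 + (2 ^+ p - 1) * t))).
  by rewrite ler_wpM2l// addr_ge0.
set q := 2 ^+ p in p1 *.
have : 0 <= (q - 1) * (t * (1 - t)) by rewrite !mulr_ge0 ?subr_ge0.
by nra.
Qed.

(** Split at [y = 1/t]: beyond it [1 + y <= (1 + t) y], and [t] is chosen so small that
    [(1 + t) ^ p <= 1 + delta]; below it the left side is bounded by a constant. A factor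
    arbitrarily close to [1] is what keeps the moment recursion contracting. *)
Lemma expr1D_le (delta : R) p : 0 < delta ->
  exists2 K, 0 <= K & forall y, 0 <= y -> (1 + y) ^+ p <= K + (1 + delta) * y ^+ p.
Proof.
move=> d0; have p0 : 0 < 2 ^+ p :> R by rewrite exprn_gt0.
pose t := Num.min 1 (delta / 2 ^+ p).
have t0 : 0 < t by rewrite lt_min ltr01 divr_gt0.
have t1 : t <= 1 by rewrite ge_min lexx.
have td : 2 ^+ p * t <= delta.
  by rewrite mulrC -ler_pdivlMr// ge_min lexx orbT.
exists ((1 + t^-1) ^+ p); first by rewrite exprn_ge0// addr_ge0// invr_ge0 ltW.
move=> y y0; have [yt|yt] := leP y t^-1.
  rewrite (@le_trans _ _ ((1 + t^-1) ^+ p))//.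
    by apply: lerXn2r; rewrite ?nnegrE ?addr_ge0 ?invr_ge0 ?(ltW t0)// lerD2l.
  by rewrite lerDl mulr_ge0 ?exprn_ge0//; lra.
have ypos : 0 < y by rewrite (lt_trans _ yt)// invr_gt0.
rewrite (@le_trans _ _ ((1 + delta) * y ^+ p))//; last first.
  by rewrite lerDr exprn_ge0// addr_ge0// invr_ge0 ltW.
rewrite (@le_trans _ _ (((1 + t) * y) ^+ p))//.
  apply: lerXn2r; rewrite ?nnegrE ?addr_ge0 ?mulr_ge0 ?addr_ge0 ?(ltW t0)//.
  rewrite mulrDl mul1r addrC lerD2l.
  by rewrite -(mulVf (lt0r_neq0 t0)) mulrC ler_wpM2l ?ltW.
rewrite exprMn ler_wpM2r ?exprn_ge0//.
by rewrite (le_trans (expr1D_le_linear _ _)) ?(ltW t0)// lerD2l.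
Qed.

Lemma sum_inv_sqr_le n : \sum_(i < n) (i.+1%:R ^+ 2)^-1 <= 2 :> R.
Proof.
have [->|n0] := posnP n; first by rewrite big_ord0.
suff: \sum_(i < n) (i.+1%:R ^+ 2)^-1 <= 2 - n%:R^-1 :> R.
  by move=> /le_trans; apply; rewrite gerBl invr_ge0.
case: n n0 => // n _; elim: n => [|n IHn].
  by rewrite big_ord_recl big_ord0 expr1n invr1; lra.
rewrite big_ord_recr/= (le_trans (lerD IHn (lexx _)))// -addrA lerD2l.
have -> : n.+2%:R = n.+1%:R + 1 :> R by rewrite natr1.
set a : R := n.+1%:R.
have a0 : 0 < a by rewrite ltr0n.
rewrite -subr_ge0.
have -> : - (a + 1)^-1 - (- a^-1 + ((a + 1) ^+ 2)^-1) = (a * (a + 1) ^+ 2)^-1.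
  by field; apply/andP; split; rewrite gt_eqF// addr_gt0.
by rewrite invr_ge0 mulr_ge0 ?exprn_ge0 ?addr_ge0 ?ltW.
Qed.

End PowerBounds.

(** * Moments of the Green sums in a clipped environment *)

Section ClippedEnvironment.
Variables (R : realType) (M : R).
Hypothesis M_gt0 : 0 < M.

(** Forces every point of path space into [[0, M]], so that the deterministic estimates,
    monotonicity and measurability hold everywhere; it is the identity for almost every
    environment. *)
Definition clip (x : env R) : int -> R := fun i => Num.max 0 (Num.min M (x i)).

Lemma clip_itv x i : 0 <= clip x i <= M.
Proof. by rewrite /clip le_max lexx/= ge_max (ltW M_gt0)/= ge_min lexx. Qed.

Lemma clip_id (x : env R) : (forall i, 0 <= x i <= M) -> clip x = x.
Proof.
move=> hx; apply/funext => i; have /andP[h0 h1] := hx i.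
by rewrite /clip min_r// max_r.
Qed.

Lemma measurable_clip i : measurable_fun setT (fun x => clip x i).
Proof.
apply: measurable_maxr => //; apply: measurable_minr => //.
exact: measurable_env_coord.
Qed.

Let mclip_sub (f : env R -> R) i : measurable_fun setT f ->
  (forall x, 1 <= lambda M - clip x i - f x) ->
  measurable_fun setT (fun x => (lambda M - clip x i - f x)^-1).
Proof.
move=> mf f1.
(* The denominators are at least [1], where the inverse agrees with the measurable real power of
   exponent [-1]. *)
have -> : (fun x => (lambda M - clip x i - f x)^-1) =
    (fun x => (lambda M - clip x i - f x) `^ (- 1)).
  by apply/funext => x; rewrite powR_inv1// (le_trans ler01 (f1 x)).
apply: (measurableT_comp (measurable_powR (-1))).
apply: measurable_funB => //; apply: measurable_funB => //.
exact: measurable_clip.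
Qed.

Lemma measurable_beta_trunc n i :
  measurable_fun setT (fun x => beta_trunc M (clip x) n i).
Proof.
elim: n i => [|n IHn] i /=; first exact: measurable_cst.
by apply: mclip_sub => // x; exact: (beta_trunc_denom_ge1 (clip_itv x)).
Qed.

Lemma measurable_beta i : measurable_fun setT (fun x => beta M (clip x) i).
Proof.
apply: (measurable_fun_cvg (fun n => measurable_beta_trunc n i)) => x _.
exact: (beta_trunc_cvg (clip_itv x)).
Qed.

Lemma measurable_green_sum L m :
  measurable_fun setT (fun x => green_sum M (clip x) L m).
Proof.
elim: L m => [|L IHL] m /=; first exact: measurable_cst.
apply: measurable_funD => //; apply: measurable_funM => //.
by apply: measurable_funX; exact: measurable_beta.
Qed.

Lemma measurable_green_trunc n :
  measurable_fun setT (fun x => green_trunc M (clip x) n).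
Proof.
elim: n => [|n IHn] /=; first exact: measurable_cst.
apply: measurable_funD => //; apply: measurable_funM => //.
by apply: measurable_funX; exact: measurable_beta_trunc.
Qed.

Lemma measurable_drop_factor i :
  measurable_fun setT (fun x => drop_factor M (clip x) i).
Proof.
have -> : (fun x => drop_factor M (clip x) i) =
    (fun x => (lambda M - clip x i - 1)^-1).
  by apply/funext => x; rewrite /drop_factor /lambda; congr (_^-1); ring.
apply: mclip_sub => // x; have /andP[] := clip_itv x i; rewrite /lambda; lra.
Qed.

Variables (nu : probability R R) (P : probability (env R) R).
Hypothesis iidP : iid_env nu P id.

Lemma integral_shift (k : int) (F : env R -> \bar R) : measurable_fun setT F ->
  (forall x, 0 <= F x)%E ->
  (\int[P]_x F (fun i => x (i + k)%R) = \int[P]_x F x)%E.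
Proof.
move=> mF F0; apply: (iid_env_integral _ iidP mF F0).
exact: (iid_env_inj (addrK k) iidP).
Qed.

Variable rho : R.
Hypothesis rho_drop : (\int[P]_x (drop_factor M (clip x) 0)%:E = rho%:E)%E.

Lemma integral_drop_factor i :
  (\int[P]_x (drop_factor M (clip x) i)%:E = rho%:E)%E.
Proof.
rewrite -rho_drop.
rewrite -(@integral_shift i (fun x => (drop_factor M (clip x) 0)%:E)).
- by apply: eq_integral => x _; rewrite /drop_factor /clip add0r.
- apply/measurable_EFinP; exact: measurable_drop_factor.
- by move=> x; rewrite lee_fin; have /andP[/ltW] := drop_factor_itv (clip_itv x) 0.
Qed.

Lemma rho_ge0 : 0 <= rho.
Proof.
rewrite -lee_fin -rho_drop integral_ge0// => x _.
by rewrite lee_fin; have /andP[/ltW] := drop_factor_itv (clip_itv x) 0.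
Qed.

Lemma integral_prod_drop_factor n :
  (\int[P]_x (\prod_(l < n) drop_factor M (clip x) l.+1%:Z)%:E = (rho ^+ n)%:E)%E.
Proof.
have d0 x i : 0 <= drop_factor M (clip x) i.
  by have /andP[/ltW] := drop_factor_itv (clip_itv x) i.
elim: n => [|n IHn].
  under eq_integral do rewrite big_ord0.
  by rewrite integral_prob_cst.
under eq_integral do rewrite big_ord_recr/= EFinM.
rewrite (iid_env_indep (m := n%:Z) iidP).
- by rewrite IHn integral_drop_factor -EFinM -exprSr.
- apply/measurable_EFinP.
  by apply: measurable_prod => l _; exact: measurable_drop_factor.
- apply/measurable_EFinP; exact: measurable_drop_factor.
- by move=> x; rewrite lee_fin prodr_ge0.
- by move=> x; rewrite lee_fin.
- move=> x y xy; congr (_%:E); apply: eq_bigr => l _.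
  by rewrite /drop_factor /clip xy//; have := ltn_ord l; lia.
- by move=> x y xy; rewrite /drop_factor /clip xy//; lia.
Qed.

Hypothesis rho_lt1 : rho < 1.

(** In [u = 1 + beta ^ 2 V] replace [beta ^ 2] by the drop factor [D], which is independent of [V]
    because [V] only sees sites further left. Since the exponent is positive, [D ^+ p.+1 <= D], so
    one step maps a moment bound [C] to [K + (1 + delta) rho C]. *)
Lemma green_sum_moment p : exists2 C, 0 <= C &
  forall L m, (\int[P]_x (green_sum M (clip x) L m ^+ p.+1)%:E <= C%:E)%E.
Proof.
have r0 := rho_ge0.
(* With this choice [1 - (1 + delta) rho = (1 - rho) (1 - rho / 2)] is positive, and the constant
   below is the fixed point of the recursion. *)
pose delta := (1 - rho) / 2.
have d0 : 0 < delta by rewrite /delta divr_gt0 ?subr_gt0.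
have [K K0 hK] := expr1D_le p.+1 d0.
have r1 : 0 < 1 - (1 + delta) * rho.
  have -> : 1 - (1 + delta) * rho = (1 - rho) * (1 - rho / 2) by rewrite /delta; field.
  move: (rho) r0 rho_lt1 => r r0 r1.
  by apply: mulr_gt0; lra.
exists (K / (1 - (1 + delta) * rho)); first by rewrite divr_ge0 // ltW.
set C := K / _; have C0 : 0 <= C by rewrite /C divr_ge0 // ltW.
have CE : K + (1 + delta) * (rho * C) = C.
  by rewrite /C; field; rewrite gt_eqF.
elim=> [|L IHL] m /=.
  under eq_integral do rewrite expr0n/=.
  by rewrite integral0 lee_fin.
have d_itv x i := drop_factor_itv (clip_itv x) i.
pose V x := green_sum M (clip x) L (m - 1).
have mV : measurable_fun setT V by exact: measurable_green_sum.
have V0 x : 0 <= V x by have /andP[] := green_sum_itv (clip_itv x) L (m - 1).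
pose D x := drop_factor M (clip x) (m - 1).
have mD : measurable_fun setT D by exact: measurable_drop_factor.
have D0 x : 0 <= D x by have /andP[/ltW] := d_itv x (m - 1).
have mVX : measurable_fun setT (fun x => V x ^+ p.+1) by exact: measurable_funX.
have mVD : measurable_fun setT (fun x => V x ^+ p.+1 * D x) by exact: measurable_funM.
have VD0 x : 0 <= V x ^+ p.+1 * D x by rewrite mulr_ge0 ?exprn_ge0.
apply: (@le_trans _ _ (\int[P]_x (K + (1 + delta) * (V x ^+ p.+1 * D x))%:E)%E).
  apply: integral_EFin_le.
  - exact: (measurable_funX _ (measurable_green_sum L.+1 m)).
  - by apply: measurable_funD => //; apply: measurable_funM.
  - move=> x; have /andP[b0 b1] := beta_sqr_itv (clip_itv x) (m - 1).
    have g0 : 0 <= 1 + beta M (clip x) (m - 1) ^+ 2 * V x.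
      by apply: addr_ge0 => //; exact: mulr_ge0.
    rewrite exprn_ge0//=.
    apply: (@le_trans _ _ ((1 + D x * V x) ^+ p.+1)).
      apply: lerXn2r; rewrite ?nnegrE//; first by apply: addr_ge0 => //; exact: mulr_ge0.
      rewrite lerD2l; apply: ler_wpM2r; first exact: V0.
      apply: (le_trans _ (beta_le_inv (clip_itv x) (m - 1))).
      by rewrite expr2 ler_piMl ?(beta_ge0 (clip_itv x)) ?(beta_le1 (clip_itv x)).
    apply: (le_trans (hK _ (mulr_ge0 (D0 x) (V0 x)))).
    rewrite lerD2l ler_wpM2l//; first by lra.
    rewrite exprMn mulrC ler_wpM2l ?exprn_ge0//.
    by rewrite exprS ler_piMr// exprn_ile1//; have /andP[] := d_itv x (m - 1).
rewrite integral_EFinD//; last 2 first.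
- by apply: measurable_funM.
- by move=> x; rewrite mulr_ge0//; lra.
rewrite integral_prob_cst integral_EFinZ//; last by lra.
have -> : (\int[P]_x (V x ^+ p.+1 * D x)%:E =
    \int[P]_x (V x ^+ p.+1)%:E * rho%:E)%E.
  rewrite -(integral_drop_factor (m - 1)).
  under eq_integral do rewrite EFinM.
  apply: (iid_env_indep (m := m - 2) iidP).
  - exact/measurable_EFinP.
  - exact/measurable_EFinP.
  - by move=> x; rewrite lee_fin exprn_ge0.
  - by move=> x; rewrite lee_fin.
  - move=> x y xy; rewrite /V (@green_sum_agree _ _ _ (clip y))// => j jm.
    by rewrite /clip xy//; lia.
  - by move=> x y xy; rewrite /D /drop_factor /clip xy//; lia.
have e1 : (\int[P]_x (V x ^+ p.+1)%:E * rho%:E <= C%:E * rho%:E)%E.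
  by apply: lee_wpmul2r; [rewrite lee_fin|exact: IHL].
apply: (@le_trans _ _ (K%:E + (1 + delta)%:E * (C%:E * rho%:E))%E).
  apply: leeD2l; apply: lee_wpmul2l => //.
  by rewrite lee_fin; apply: addr_ge0 => //; exact: ltW.
by rewrite -!EFinM -EFinD lee_fin [C * rho]mulrC CE.
Qed.

(** The twelfth moments are bounded uniformly in depth and site, so their sum with weights
    [(1 + |i|) ^ (-2)] has finite mean; each single term is at most the sum. In [g] the depth and
    the range of sites grow together, which gives one monotone sequence. *)
Lemma ae_green_sum_growth : \forall x \ae P, exists C, forall L i,
  green_sum M (clip x) L i ^+ 12 <= C * (1 + `|i|%N%:R) ^+ 2.
Proof.
have [C C0 hC] := green_sum_moment 11.
pose g n x := \sum_(i < n) (i.+1%:R ^+ 2)^-1 *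
  (green_sum M (clip x) n i%:Z ^+ 12 + green_sum M (clip x) n (- i%:Z) ^+ 12).
have G0 x n i : 0 <= green_sum M (clip x) n i.
  by have /andP[] := green_sum_itv (clip_itv x) n i.
have mG n i : measurable_fun setT (fun x => green_sum M (clip x) n i ^+ 12).
  by apply: measurable_funX; exact: measurable_green_sum.
have mt n i : measurable_fun setT (fun x => (i.+1%:R ^+ 2)^-1 *
  (green_sum M (clip x) n i%:Z ^+ 12 + green_sum M (clip x) n (- i%:Z) ^+ 12)).
  by apply: measurable_funM => //; exact: measurable_funD.
have t0 n i x : 0 <= (i.+1%:R ^+ 2)^-1 *
  (green_sum M (clip x) n i%:Z ^+ 12 + green_sum M (clip x) n (- i%:Z) ^+ 12).
  by rewrite mulr_ge0 ?invr_ge0 ?exprn_ge0// addr_ge0 ?exprn_ge0.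
have mg n : measurable_fun setT (g n).
  by apply: measurable_sum => i; exact: mt.
have g0 n x : 0 <= g n x by apply: sumr_ge0 => i _; exact: t0.
have nd_g x : nondecreasing_seq (g ^~ x).
  apply/nondecreasing_seqP => n; rewrite /g big_ord_recr.
  apply: ler_wpDr; first exact: (t0 n.+1 n x).
  apply: ler_sum => i _; rewrite ler_wpM2l ?invr_ge0 ?exprn_ge0//.
  by apply: lerD; apply: lerXn2r; rewrite ?nnegrE//; exact: (green_sum_nd (clip_itv x)).
have gC n : (\int[P]_x (g n x)%:E <= (2 * (C + C))%:E)%E.
  rewrite integral_EFin_sum => [||i x]; [|by move=> i; exact: mt|exact: t0].
  apply: (@le_trans _ _ (\sum_(i < n) (((i.+1%:R ^+ 2)^-1 : R) * (C + C))%:E)%E).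
    apply: lee_sum => i _.
    have mS := measurable_funD (mG n i%:Z) (mG n (- i%:Z)).
    have X0 j x : 0 <= green_sum M (clip x) n j ^+ 12 by rewrite exprn_ge0.
    have S0 x := addr_ge0 (X0 i%:Z x) (X0 (- i%:Z) x).
    have k0 : 0 <= (i.+1%:R ^+ 2)^-1 :> R by rewrite invr_ge0 exprn_ge0.
    rewrite (integral_EFinZ P mS S0 k0) EFinM; apply: lee_wpmul2l; first by rewrite lee_fin.
    rewrite (integral_EFinD P (mG n i%:Z) (mG n (- i%:Z)) (X0 _) (X0 _)).
    by rewrite EFinD leeD.
  rewrite sumEFin lee_fin -mulr_suml ler_wpM2r ?addr_ge0//.
  exact: sum_inv_sqr_le.
have := ae_bounded_nd mg g0 nd_g gC.
apply: filterS => x [B hB]; exists B => L i.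
pose n := maxn L `|i|%N.+1.
apply: (@le_trans _ _ (green_sum M (clip x) n i ^+ 12)).
  apply: lerXn2r; rewrite ?nnegrE//.
  by apply: (green_sum_nd (clip_itv x)); exact: leq_maxl.
have n_gt : (`|i| < n)%N by rewrite leq_max leqnn orbT.
rewrite -ler_pdivrMr; last by rewrite exprn_gt0// ltr_wpDr.
rewrite mulrC; apply: le_trans (hB n); rewrite /g (bigD1 (Ordinal n_gt))//=.
apply: ler_wpDr; first by apply: sumr_ge0 => j _; exact: t0.
rewrite nat1r ler_wpM2l ?invr_ge0 ?exprn_ge0//.
have [i0|i0] := leP 0 i.
  by rewrite gez0_abs// ler_wpDr ?exprn_ge0.
by rewrite ltz0_abs// opprK ler_wpDl ?exprn_ge0.
Qed.

End ClippedEnvironment.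

Section RealSequences.
Variable R : realType.

(** Each of the [m + 1] terms of [1 + q + ... + q ^ m] is at least [q ^ m]. It is used to bound
    [m.+1 q ^ m] by [1 / (1 - q)]. *)
Lemma natrX_le_geometric (q : R) m : 0 <= q < 1 ->
  m.+1%:R * (1 - q) * q ^+ m <= 1 - q ^+ m.+1.
Proof.
move=> /andP[q0 q1]; elim: m => [|m IHm]; first by rewrite expr0 expr1; lra.
have qm0 : 0 <= q ^+ m.+1 by rewrite exprn_ge0.
have qm1 : q ^+ m.+1 <= 1 by rewrite exprn_ile1 // ltW.
have := ler_wpM2l q0 IHm.
rewrite -(natr1 m.+1) [q ^+ m.+2]exprS.
have -> : q * (m.+1%:R * (1 - q) * q ^+ m) = m.+1%:R * (1 - q) * q ^+ m.+1.
  by rewrite exprS; ring.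
by set u := q ^+ m.+1 in qm0 qm1 *; nra.
Qed.

Lemma sum_geometric_le (r : R) n : 0 <= r < 1 -> \sum_(m < n) r ^+ m <= (1 - r)^-1.
Proof.
move=> /andP[r0 r1].
rewrite -div1r ler_pdivlMr ?subr_gt0// mulrC.
have : r ^+ n - 1 = (r - 1) * \sum_(i < n) r ^+ i by rewrite subrX1.
have := exprn_ge0 n r0; set s := \sum_(i < n) _; lra.
Qed.

Lemma sum_poly_geometric_le (rho : R) : 0 <= rho < 1 ->
  exists2 C, 0 <= C &
    forall n, \sum_(m < n) (1 + m%:R + m%:R ^+ 2) * rho ^+ m <= C.
Proof.
(* Averaging with [1] twice gives [q < 1] with [rho <= q ^ 4], by the inequality of arithmetic and
   geometric means. Two of the four factors [q ^ m] absorb the quadratic polynomial, and the other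
   two leave a geometric series. *)
move=> /andP[r0 r1]; pose q1 := (1 + rho) / 2; pose q := (1 + q1) / 2.
have [q10 q11] : 0 <= q1 /\ q1 < 1 by rewrite /q1; lra.
have [q0 q_lt1] : 0 <= q /\ q < 1 by rewrite /q; lra.
have rq1 : rho <= q1 ^+ 2.
  rewrite /q1 -subr_ge0.
  have -> : ((1 + rho) / 2) ^+ 2 - rho = ((1 - rho) / 2) ^+ 2 by field.
  exact: sqr_ge0.
have q1q : q1 <= q ^+ 2.
  rewrite /q -subr_ge0.
  have -> : ((1 + q1) / 2) ^+ 2 - q1 = ((1 - q1) / 2) ^+ 2 by field.
  exact: sqr_ge0.
have rq : rho <= q ^+ 4.
  by rewrite (le_trans rq1)// (exprM q 2 2); apply: lerXn2r; rewrite ?nnegrE ?sqr_ge0.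
have D0 : 0 < 1 - q by lra.
have q20 : 0 <= q ^+ 2 by exact: sqr_ge0.
have q21 : q ^+ 2 < 1 by rewrite exprn_ilt1.
exists ((1 - q) ^- 2 * (1 - q ^+ 2)^-1).
  by rewrite mulr_ge0// invr_ge0 ?exprn_ge0 ?subr_ge0// ltW.
move=> n; apply: (@le_trans _ _ (\sum_(m < n) (1 - q) ^- 2 * (q ^+ 2) ^+ m)); last first.
  rewrite -mulr_sumr ler_wpM2l ?invr_ge0 ?exprn_ge0 ?(ltW D0)//.
  by rewrite sum_geometric_le// q20.
apply: ler_sum => m _.
have rm : rho ^+ m <= (q ^+ m) ^+ 2 * (q ^+ 2) ^+ m.
  rewrite (le_trans (lerXn2r m _ _ rq)) ?nnegrE ?exprn_ge0//.
  rewrite -!exprM -exprD.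
  by have -> : (4 * m = m * 2 + 2 * m)%N by lia.
have h : m.+1%:R * q ^+ m <= (1 - q)^-1.
  rewrite -div1r ler_pdivlMr// mulrAC.
  by rewrite (le_trans (natrX_le_geometric _ _)) ?q0// gerBl exprn_ge0.
apply: (@le_trans _ _ (m.+1%:R ^+ 2 * ((q ^+ m) ^+ 2 * (q ^+ 2) ^+ m))).
  have m0 : 0 <= 1 + m%:R + m%:R ^+ 2 :> R.
    by apply: addr_ge0; [apply: addr_ge0|exact: sqr_ge0].
  apply: (ler_pM m0 (exprn_ge0 _ r0) _ rm).
  by rewrite -natr1; have : 0 <= m%:R :> R by []; set a : R := m%:R; nra.
rewrite mulrA -exprMn ler_wpM2r ?exprn_ge0//.
by rewrite -exprVn; apply: lerXn2r; rewrite ?nnegrE ?mulr_ge0 ?exprn_ge0 ?invr_ge0 ?(ltW D0).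
Qed.

Lemma cvg_natr_ratio : (n%:R / n.+1%:R : R) @[n --> \oo] --> (1 : R).
Proof.
have -> : (fun n => n%:R / n.+1%:R : R) = (fun n => 1 - harmonic n).
  apply/funext => n; rewrite /harmonic /= -natr1.
  by field; rewrite natr1 pnatr_eq0.
rewrite -[X in _ --> X]subr0; apply: cvgB; [exact: cvg_cst|exact: cvg_harmonic].
Qed.

(* Interpolation between consecutive squares [k ^ 2 <= n < k.+1 ^ 2]. *)
Lemma cvg_div_of_squares (F : nat -> R) (s : R) :
  (forall n, 0 <= F n) -> nondecreasing_seq F ->
  (F (k.+1 ^ 2)%N / (k.+1 ^ 2)%:R) @[k --> \oo] --> s ->
  (F n / n%:R) @[n --> \oo] --> s.
Proof.
move=> F0 ndF Fs.
pose k n := Nat.sqrt n.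
have k_spec n : (k n ^ 2 <= n < (k n).+1 ^ 2)%N.
  by have := Nat.sqrt_spec n (Nat.le_0_l n); rewrite -/(k n); lia.
have k_oo : k n @[n --> \oo] --> \oo.
  move=> S [A _ AS]; exists (A ^ 2)%N => // n /= An; apply: AS => /=.
  by have := k_spec n; rewrite leqNgt; nia.
have Fs' : (F (k ^ 2)%N / (k ^ 2)%:R) @[k --> \oo] --> s by rewrite -cvg_shiftS.
have r2 : ((n%:R / n.+1%:R) ^+ 2 : R) @[n --> \oo] --> (1 : R).
  rewrite -[X in _ --> X]mulr1; under eq_fun do rewrite expr2.
  by apply: cvgM; exact: cvg_natr_ratio.
have r2' : (((n%:R / n.+1%:R) ^+ 2)^-1 : R) @[n --> \oo] --> (1 : R).
  by rewrite -[X in _ --> X]invr1; apply: cvgV => //; exact: oner_neq0.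
have lo : F (k n ^ 2)%N / (k n ^ 2)%:R * ((k n)%:R / (k n).+1%:R) ^+ 2
    @[n --> \oo] --> s.
  have h : F (n ^ 2)%N / (n ^ 2)%:R * (n%:R / n.+1%:R) ^+ 2 @[n --> \oo] --> s.
    by rewrite -[X in _ --> X]mulr1; exact: cvgM.
  exact: (cvg_comp _ _ k_oo h).
have hi : F ((k n).+1 ^ 2)%N / ((k n).+1 ^ 2)%:R * (((k n)%:R / (k n).+1%:R) ^+ 2)^-1
    @[n --> \oo] --> s.
  have h : F (n.+1 ^ 2)%N / (n.+1 ^ 2)%:R * ((n%:R / n.+1%:R) ^+ 2)^-1 @[n --> \oo] --> s.
    by rewrite -[X in _ --> X]mulr1; exact: cvgM.
  exact: (cvg_comp _ _ k_oo h).
apply: (squeeze_cvgr _ lo hi).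
exists 1%N => // n /= n1; have /andP[k1 k2] := k_spec n.
have kpos : (0 < k n)%N by rewrite lt0n; apply/eqP => k0; move: k2; rewrite k0; lia.
have k0 : 0 < (k n)%:R :> R by rewrite ltr0n.
have kS0 : 0 < (k n).+1%:R :> R by rewrite ltr0n.
have n0 : 0 < n%:R :> R by rewrite ltr0n.
apply/andP; split.
  have -> : F (k n ^ 2)%N / (k n ^ 2)%:R * ((k n)%:R / (k n).+1%:R) ^+ 2
     = F (k n ^ 2)%N / (k n).+1%:R ^+ 2.
    by rewrite natrX; field; rewrite !gt_eqF.
  apply: ler_pM; rewrite ?invr_ge0 ?exprn_ge0// ?ndF//.
  by rewrite lef_pV2 ?posrE ?exprn_gt0// -natrX ler_nat ltnW.
have -> : F ((k n).+1 ^ 2)%N / ((k n).+1 ^ 2)%:R * (((k n)%:R / (k n).+1%:R) ^+ 2)^-1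
   = F ((k n).+1 ^ 2)%N / (k n)%:R ^+ 2.
  by rewrite natrX; field; rewrite !gt_eqF.
apply: ler_pM; rewrite ?invr_ge0 ?exprn_ge0// ?ndF//; first by rewrite ltnW.
by rewrite lef_pV2 ?posrE ?exprn_gt0// -natrX ler_nat.
Qed.

Lemma cvg0_of_bounded_sum (f : nat -> R) (B : R) : (forall n, 0 <= f n) ->
  (forall n, \sum_(k < n) f k <= B) -> f n @[n --> \oo] --> (0 : R).
Proof.
move=> f0 fB; apply: cvg_series_cvg_0; apply: nondecreasing_is_cvgn.
  by apply: nondecreasing_series.
by exists B => _ [n _ <-]; rewrite /series /= big_mkord.
Qed.

End RealSequences.

(** * Law of large numbers for the crossing times *)

Lemma iid_env_indep_EFin (R : realType) (nu : probability R R)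
    (P : probability (env R) R) (m : int) (F G : env R -> R) :
  iid_env nu P id -> measurable_fun setT F -> measurable_fun setT G ->
  (forall x, 0 <= F x) -> (forall x, 0 <= G x) ->
  depends_on (fun i => i <= m) (fun x => (F x)%:E) ->
  depends_on (fun i => m < i) (fun x => (G x)%:E) ->
  (\int[P]_x (F x * G x)%:E = (\int[P]_x (F x)%:E) * (\int[P]_x (G x)%:E))%E.
Proof.
move=> iidP mF mG F0 G0 dF dG; under eq_integral do rewrite EFinM.
apply: (iid_env_indep iidP _ _ _ _ dF dG).
- exact/measurable_EFinP.
- exact/measurable_EFinP.
- by move=> x; rewrite lee_fin.
- by move=> x; rewrite lee_fin.
Qed.

Section CrossingTimes.
Variables (R : realType) (M : R).
Hypothesis M_gt0 : 0 < M.
Let lam := lambda M.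
Let lam_gt0 : 0 < lam. Proof. by rewrite /lam /lambda addr_gt0. Qed.
Let lam_ge0 : 0 <= lam. Proof. exact: ltW. Qed.

Definition crossing_sum L m (x : env R) : R :=
  lam * (beta M (clip M x) m * green_sum M (clip M x) L m).

(* The quenched mean of the time the chain with [kappa = 1] needs to go from
   [m] to [m + 1]. *)
Definition crossing_mean m (x : env R) : \bar R :=
  limn (fun L => (crossing_sum L m x)%:E).

Let cs := crossing_sum.
Let citv x i : 0 <= clip M x i <= M := clip_itv M_gt0 x i.

Lemma crossing_sum_ge0 L m x : 0 <= cs L m x.
Proof.
rewrite /cs /crossing_sum !mulr_ge0 ?(beta_ge0 (citv x))//.
by have /andP[] := green_sum_itv (citv x) L m.
Qed.

Lemma crossing_sum_nd m x : nondecreasing_seq (fun L => cs L m x).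
Proof.
move=> i j ij; rewrite /cs /crossing_sum !ler_wpM2l ?(beta_ge0 (citv x))//.
exact: (green_sum_nd (citv x)).
Qed.

Lemma measurable_crossing_sum L m : measurable_fun setT (cs L m).
Proof.
apply: measurable_funM => //; apply: measurable_funM.
  exact: measurable_beta.
exact: measurable_green_sum.
Qed.

Lemma crossing_sum_shift (k : int) L m x :
  cs L m (fun i => x (i + k)) = cs L (m + k) x.
Proof.
rewrite /cs /crossing_sum.
have -> : clip M (fun i => x (i + k)) = (fun i => clip M x (i + k)) by [].
by rewrite beta_shift green_sum_shift.
Qed.

Lemma crossing_mean_shift (k : int) m x :
  crossing_mean m (fun i => x (i + k)) = crossing_mean (m + k) x.
Proof.
rewrite /crossing_mean.
suff -> : (fun L => (cs L m (fun i => x (i + k)))%:E) =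
    (fun L => (cs L (m + k) x)%:E) by [].
by apply/funext => L; rewrite crossing_sum_shift.
Qed.

Lemma crossing_sum_le_mean L m x : ((cs L m x)%:E <= crossing_mean m x)%E.
Proof. exact: (le_limn_nd (crossing_sum_nd m)). Qed.

Lemma crossing_mean_ge0 m x : (0 <= crossing_mean m x)%E.
Proof.
by rewrite (le_trans _ (crossing_sum_le_mean 0 m x))// lee_fin crossing_sum_ge0.
Qed.

Lemma measurable_crossing_mean m : measurable_fun setT (crossing_mean m).
Proof.
apply: measurable_limn_nd; first by move=> n; exact: measurable_crossing_sum.
exact: crossing_sum_nd.
Qed.

(** The first term is already [lam * beta m], and [beta m >= 1 / (lam - w m) >= 1 / lam]. This makes
    the mean crossing time positive. *)
Lemma crossing_sum1_ge1 m x : 1 <= cs 1 m x.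
Proof.
rewrite /cs /crossing_sum /= mulr0 addr0 mulr1.
have /andP[h0 h1] := citv x m.
have := beta_trunc_le (citv x) 1 m; rewrite /= subr0 => h.

rewrite -(@mulfV _ lam) ?gt_eqF// ler_wpM2l// (le_trans _ h)//.
by rewrite lef_pV2 ?posrE -/lam//; move: h1 lam_gt0; rewrite /lam /lambda; lra.
Qed.

Lemma green_trunc_le x n :
  green_trunc M (clip M x) n <= green_sum M (clip M x) n n%:Z.
Proof.
elim: n => //= n IHn; have -> : n.+1%:Z - 1 = n%:Z by lia.
rewrite lerD2l; apply: ler_pM => //.
- exact: sqr_ge0.
- by have /andP[] := green_trunc_itv (citv x) n.
- apply: lerXn2r; rewrite ?nnegrE ?(beta_ge0 (citv x))//.
    by have /andP[] := beta_trunc_itv (citv x) n n.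
  exact: (beta_trunc_le (citv x)).
Qed.

Variables (nu : probability R R) (P : probability (env R) R).
Hypothesis iidP : iid_env nu P id.
Variable rho : R.
Hypothesis rho_drop : (\int[P]_x (drop_factor M (clip M x) 0)%:E = rho%:E)%E.
Hypothesis rho_lt1 : rho < 1.

Definition mean_speed_inv : \bar R := (\int[P]_x crossing_mean 0 x)%E.

Lemma integral_crossing_mean m : (\int[P]_x crossing_mean m x = mean_speed_inv)%E.
Proof.
rewrite /mean_speed_inv.
rewrite -(@integral_shift _ _ _ iidP m (crossing_mean 0)).
- by apply: eq_integral => x _; rewrite crossing_mean_shift add0r.
- exact: measurable_crossing_mean.
- exact: crossing_mean_ge0.
Qed.

Lemma integral_crossing_sum_le L m :
  (\int[P]_x (cs L m x)%:E <= mean_speed_inv)%E.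
Proof.
rewrite -(integral_crossing_mean m); apply: ge0_le_integral => //.
- by move=> x _; rewrite lee_fin crossing_sum_ge0.
- by apply/measurable_EFinP; exact: measurable_crossing_sum.
- exact: measurable_crossing_mean.
- by move=> x _; exact: crossing_sum_le_mean.
Qed.

Lemma mean_speed_inv_gt0 : (0 < mean_speed_inv)%E.
Proof.
apply: (@lt_le_trans _ _ 1%E); first by rewrite lte01.
apply: le_trans (integral_crossing_sum_le 1 0).
rewrite -[leLHS](integral_prob_cst P 1); apply: integral_EFin_le => //.
  exact: measurable_crossing_sum.
by move=> x; rewrite ler01 crossing_sum1_ge1.
Qed.

Lemma mean_speed_inv_lty : (mean_speed_inv < +oo)%E.
Proof.
have [C C0 hC] := green_sum_moment M_gt0 iidP rho_drop rho_lt1 0.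
apply: (@le_lt_trans _ _ (lam * C)%:E); last exact: ltry.
apply: integral_limn_le.
- by move=> n; exact: measurable_crossing_sum.
- by move=> n x; exact: crossing_sum_ge0.
- by move=> x; exact: crossing_sum_nd.
- move=> L; have g0 x := proj1 (andP (green_sum_itv (citv x) L 0)).
  apply: (@le_trans _ _ (\int[P]_x (lam * green_sum M (clip M x) L 0)%:E)%E).
    apply: integral_EFin_le; first exact: measurable_crossing_sum.
      by apply: measurable_funM => //; exact: measurable_green_sum.
    move=> x; rewrite crossing_sum_ge0/= ler_wpM2l//.
    by rewrite ler_piMl// (beta_le1 (citv x)).
  rewrite integral_EFinZ//; last exact: measurable_green_sum.
  by rewrite EFinM lee_wpmul2l ?lee_fin//; exact: hC.
Qed.

Let es := fine mean_speed_inv.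

Let esE : mean_speed_inv = es%:E.
Proof.
rewrite /es fineK// ge0_fin_numE ?mean_speed_inv_lty//.
exact/ltW/mean_speed_inv_gt0.
Qed.

Let rho_itv : 0 <= rho < 1.
Proof. by rewrite rho_lt1 andbT; exact: (rho_ge0 M_gt0 rho_drop). Qed.

(** By [green_compare] the crossing sum at [n] is at most [B] plus an error. [B] lives on the sites
    after [0] and is below a crossing sum, so its product with the sum at [0] contributes at most
    [es ^ 2]. The error contributes the mean of [D], on the sites up to [0], times the mean
    [rho ^ n] of [Z]; second moments of the Green sum bound the former. *)
Lemma crossing_sum_correlation : exists2 C, 0 <= C & forall L n,
  (\int[P]_x (cs L 0 x * cs (L + n) n%:Z x)%:E <=
   (es ^+ 2 + C * ((1 + n%:R + n%:R ^+ 2) * rho ^+ n))%:E)%E.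
Proof.
have [C C0 hC] := green_sum_moment M_gt0 iidP rho_drop rho_lt1 1.
have /andP[r0 r1] := rho_itv.
exists (lam ^+ 2 * (1 + C)); first by rewrite mulr_ge0 ?sqr_ge0 ?addr_ge0.
move=> L n.
pose V x := green_sum M (clip M x) L 0.
have mV : measurable_fun setT V by exact: measurable_green_sum.
have V0 x : 0 <= V x by have /andP[] := green_sum_itv (citv x) L 0.
pose B x := lam * (beta_trunc M (clip M x) n n%:Z * green_trunc M (clip M x) n).
pose Z x := \prod_(l < n) drop_factor M (clip M x) l.+1%:Z.
pose D x := lam * (cs L 0 x * (V x + n%:R ^+ 2 + n%:R)).
have t0 x := proj1 (andP (beta_trunc_itv (citv x) n n)).
have g0 x := proj1 (andP (green_trunc_itv (citv x) n)).
have B0 x : 0 <= B x by rewrite /B !mulr_ge0.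
have Z0 x : 0 <= Z x.
  by apply: prodr_ge0 => l _; have /andP[/ltW] := drop_factor_itv (citv x) l.+1.
have A0 x := crossing_sum_ge0 L 0 x.
have n0 : 0 <= n%:R ^+ 2 + n%:R :> R by rewrite addr_ge0 ?sqr_ge0.
have D0 x : 0 <= D x.
  apply: mulr_ge0 => //; apply: mulr_ge0 => //.
  by rewrite -addrA; exact: addr_ge0.
have mB : measurable_fun setT B.
  apply: measurable_funM => //; apply: measurable_funM.
    exact: measurable_beta_trunc.
  exact: measurable_green_trunc.
have mZ : measurable_fun setT Z.
  by apply: measurable_prod => l _; exact: measurable_drop_factor.
have mA : measurable_fun setT (cs L 0) by exact: measurable_crossing_sum.
have mD : measurable_fun setT D.
  apply: measurable_funM => //; apply: measurable_funM => //.
  by apply: measurable_funD => //; apply: measurable_funD.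
have dA : depends_on (fun i => i <= 0) (fun x => (cs L 0 x)%:E).
  move=> x y xy; rewrite /cs /crossing_sum.
  rewrite (@beta_agree _ _ (clip M x) (clip M y)); last first.
    by move=> j j0; rewrite /clip xy.
  rewrite (@green_sum_agree _ _ (clip M x) (clip M y))// => j j0.
  by rewrite /clip xy// ltW.
have dB : depends_on (fun i => 0 < i) (fun x => (B x)%:E).
  move=> x y xy; rewrite /B (@beta_trunc_agree _ _ (clip M x) (clip M y)); last first.
    by move=> j j0; rewrite /clip xy//; lia.
  rewrite (@green_trunc_agree _ _ (clip M x) (clip M y))// => j j0.
  by rewrite /clip xy//; lia.
have dZ : depends_on (fun i => 0 < i) (fun x => (Z x)%:E).
  by move=> x y xy; congr (_%:E); apply: eq_bigr => l _; rewrite /drop_factor /clip xy.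
have dD : depends_on (fun i => i <= 0) (fun x => (D x)%:E).
  move=> x y xy; have [Axy] := dA x y xy; rewrite /D Axy /V.
  rewrite (@green_sum_agree _ _ (clip M x) (clip M y))// => j j0.
  by rewrite /clip xy// ltW.
apply: (@le_trans _ _ (\int[P]_x (cs L 0 x * B x + D x * Z x)%:E)%E).
  apply: integral_EFin_le.
  - by apply: measurable_funM => //; exact: measurable_crossing_sum.
  - by apply: measurable_funD; exact: measurable_funM.
  - move=> x; rewrite mulr_ge0//= ?crossing_sum_ge0//=.
    have := green_compare (citv x) L n => h.
    have -> : cs L 0 x * B x + D x * Z x = cs L 0 x * (lam *
       (beta_trunc M (clip M x) n n%:Z * green_trunc M (clip M x) n +
        Z x * (V x + n%:R ^+ 2 + n%:R))) by rewrite /B /D; ring.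
    by rewrite ler_wpM2l// /cs /crossing_sum ler_wpM2l.
have mAB : measurable_fun setT (fun x => cs L 0 x * B x) by exact: measurable_funM.
have mDZ : measurable_fun setT (fun x => D x * Z x) by exact: measurable_funM.
have AB0 x : 0 <= cs L 0 x * B x by rewrite mulr_ge0.
have DZ0 x : 0 <= D x * Z x by rewrite mulr_ge0.
rewrite (integral_EFinD P mAB mDZ AB0 DZ0) EFinD; apply: leeD.
  rewrite (iid_env_indep_EFin iidP mA mB A0 B0 dA dB).
  rewrite expr2 EFinM -!esE; apply: lee_pmul.
  - by apply: integral_ge0 => x _; rewrite lee_fin.
  - by apply: integral_ge0 => x _; rewrite lee_fin.
  - exact: integral_crossing_sum_le.
  - apply: le_trans (integral_crossing_sum_le n n%:Z).
    apply: integral_EFin_le => //; first exact: measurable_crossing_sum.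
    move=> x; rewrite B0/= /B /cs /crossing_sum ler_wpM2l//.
    apply: ler_pM => //; first exact: (beta_trunc_le (citv x)).
    exact: green_trunc_le.
rewrite (iid_env_indep_EFin iidP mD mZ D0 Z0 dD dZ).
rewrite (integral_prod_drop_factor M_gt0 iidP rho_drop).
rewrite mulrA EFinM.
apply: lee_wpmul2r; first by rewrite lee_fin exprn_ge0.
set c := 1 + n%:R + n%:R ^+ 2.
have c0 : 0 <= c by rewrite /c -addrA addr_ge0// addrC.
have lc0 : 0 <= lam ^+ 2 * c by rewrite mulr_ge0 ?sqr_ge0.
have mV2 : measurable_fun setT (fun x => V x ^+ 2) by exact: measurable_funX.
apply: (@le_trans _ _ (\int[P]_x (lam ^+ 2 * c * (1 + V x ^+ 2))%:E)%E).
  apply: integral_EFin_le => //.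
    by apply: measurable_funM => //; apply: measurable_funD.
  move=> x; rewrite D0/= /D.
  have A_le : cs L 0 x <= lam * V x.
    rewrite /cs /crossing_sum ler_wpM2l// ler_piMl ?(beta_le1 (citv x))//.
    exact: V0.
  apply: (@le_trans _ _ (lam * (lam * V x * (V x + n%:R ^+ 2 + n%:R)))).
    by rewrite ler_wpM2l// ler_wpM2r// -addrA addr_ge0.
  have -> : lam * (lam * V x * (V x + n%:R ^+ 2 + n%:R)) =
     lam ^+ 2 * (V x * (V x + n%:R ^+ 2 + n%:R)) by ring.
  rewrite -mulrA ler_wpM2l ?sqr_ge0//.
  rewrite -subr_ge0 /c.
  have -> : (1 + n%:R + n%:R ^+ 2) * (1 + V x ^+ 2) - V x * (V x + n%:R ^+ 2 + n%:R)
    = 1 + (n%:R ^+ 2 + n%:R) * (1 + V x ^+ 2 - V x) by ring.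
  apply: addr_ge0 => //; apply: mulr_ge0 => //.
  by have := V0 x; set v := V x; nra.
have m1V : measurable_fun setT (fun x => 1 + V x ^+ 2) by exact: measurable_funD.
rewrite integral_EFinZ//; last by move=> x; rewrite addr_ge0 ?sqr_ge0.
have -> : lam ^+ 2 * (1 + C) * c = lam ^+ 2 * c * (1 + C) by ring.
rewrite [leRHS]EFinM; apply: lee_wpmul2l; first by rewrite lee_fin.
rewrite integral_EFinD//; last by move=> x; exact: sqr_ge0.
by rewrite integral_prob_cst EFinD leeD2l//; exact: hC.
Qed.

End CrossingTimes.

Section LawOfLargeNumbers.
Variables (R : realType) (M : R).
Hypothesis M_gt0 : 0 < M.
Variables (nu : probability R R) (P : probability (env R) R).
Hypothesis iidP : iid_env nu P id.
Variable rho : R.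
Hypothesis rho_drop : (\int[P]_x (drop_factor M (clip M x) 0)%:E = rho%:E)%E.
Hypothesis rho_lt1 : rho < 1.

Let es := fine (mean_speed_inv M P).

Let esE : mean_speed_inv M P = es%:E.
Proof.
rewrite /es fineK// ge0_fin_numE.
  exact: (mean_speed_inv_lty M_gt0 iidP rho_drop rho_lt1).
exact/ltW/(mean_speed_inv_gt0 M_gt0 iidP).
Qed.

(* Real-valued version of [crossing_mean], equal to [0] where the latter is
   infinite. *)
Definition crossing_time m (x : env R) : R := fine (crossing_mean M m x).

Let ct := crossing_time.

Lemma crossing_time_ge0 m x : 0 <= ct m x.
Proof. by apply: fine_ge0; exact: crossing_mean_ge0. Qed.

Lemma measurable_crossing_time m : measurable_fun setT (ct m).
Proof. by apply: measurableT_comp => //; exact: measurable_crossing_mean. Qed.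

Lemma crossing_sum_cvg m x : crossing_mean M m x \is a fin_num ->
  crossing_sum M L m x @[L --> \oo] --> ct m x.
Proof.
move=> fx.
have h : (crossing_sum M L m x)%:E @[L --> \oo] --> (ct m x)%:E.
  rewrite /ct /crossing_time fineK//.
  apply: ereal_nondecreasing_is_cvgn => i j ij.
  by rewrite lee_fin; exact: crossing_sum_nd.
by move/fine_cvgP: h => [].
Qed.

Lemma ae_crossing_mean_fin m : \forall x \ae P, crossing_mean M m x \is a fin_num.
Proof.
have ige : P.-integrable setT (crossing_mean M m).
  apply/integrableP; split; first exact: measurable_crossing_mean.
  under eq_integral do rewrite gee0_abs ?crossing_mean_ge0//.
  rewrite (integral_crossing_mean M_gt0 iidP).
  exact: (mean_speed_inv_lty M_gt0 iidP rho_drop rho_lt1).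
by have := integrable_ae measurableT ige; apply: filterS => x; apply.
Qed.

Lemma integral_crossing_time m : (\int[P]_x (ct m x)%:E = es%:E)%E.
Proof.
rewrite -esE -(integral_crossing_mean M_gt0 iidP m); apply: ae_eq_integral => //.
- by apply/measurable_EFinP; exact: measurable_crossing_time.
- exact: measurable_crossing_mean.
- have := ae_crossing_mean_fin m; apply: filterS => x fx _.
  by rewrite /ct /crossing_time fineK.
Qed.

(** Stationarity moves the left site to [0]; monotone convergence in the depth [L] then transfers
    the bound from the partial sums. *)
Lemma crossing_time_correlation : exists2 C, 0 <= C & forall (j n : nat),
  (\int[P]_x (ct j%:Z x * ct (j + n)%:Z x)%:E <=
   (es ^+ 2 + C * ((1 + n%:R + n%:R ^+ 2) * rho ^+ n))%:E)%E.
Proof.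
have [C C0 hC] := crossing_sum_correlation M_gt0 iidP rho_drop rho_lt1.
exists C => // j n.
have ct0 := crossing_time_ge0; have mct := measurable_crossing_time.
have -> : (\int[P]_x (ct j%:Z x * ct (j + n)%:Z x)%:E =
    \int[P]_x (ct 0 x * ct n%:Z x)%:E)%E.
  rewrite -(integral_shift iidP j (F := fun x => (ct 0 x * ct n%:Z x)%:E)).
  - apply: eq_integral => x _; rewrite /ct /crossing_time !crossing_mean_shift add0r.
    by have -> : n%:Z + j%:Z = (j + n)%:Z by lia.
  - by apply/measurable_EFinP; exact: measurable_funM.
  - by move=> x; rewrite lee_fin mulr_ge0.
pose g L x := crossing_sum M L 0 x * crossing_sum M (L + n) n%:Z x.
have cs0 L m x := crossing_sum_ge0 M_gt0 L m x.
have mg L : measurable_fun setT (g L).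
  by apply: measurable_funM; exact: measurable_crossing_sum.
have g0 L x : 0 <= g L x by rewrite mulr_ge0.
have nd_g x : nondecreasing_seq (g ^~ x).
  move=> i k ik; apply: ler_pM => //; apply: (crossing_sum_nd M_gt0) => //.
  by rewrite leq_add2r.
apply: le_trans (integral_limn_le mg g0 nd_g (fun L => hC L n)).
apply: ge0_le_integral => //.
- by move=> x _; rewrite lee_fin mulr_ge0.
- by apply/measurable_EFinP; exact: measurable_funM.
- exact: measurable_limn_nd.
move=> x _.
have gl L := le_limn_nd nd_g x L.
set G := limn _ in gl *.
have G0 : (0 <= G)%E by rewrite (le_trans _ (gl 0%N))// lee_fin.
(* Where a crossing mean is infinite, its real version is [0] and the product vanishes. *)
have [f0|f0] := boolP (crossing_mean M 0 x \is a fin_num); last first.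
  rewrite /ct {1}/crossing_time; case: (crossing_mean M 0 x) f0 => //=; by rewrite mul0r.
have [f1|f1] := boolP (crossing_mean M n x \is a fin_num); last first.
  rewrite /ct {2}/crossing_time; case: (crossing_mean M n x) f1 => //=; by rewrite mulr0.
have [fG|] := boolP (G \is a fin_num); last first.
  by rewrite ge0_fin_numE// -leNgt leye_eq => /eqP->; rewrite leey.
rewrite -(fineK fG) lee_fin.
have cg : g L x @[L --> \oo] --> ct 0 x * ct n x.
  apply: cvgM; first exact: crossing_sum_cvg.
  rewrite (_ : (fun L => crossing_sum M (L + n) n x)
     = (fun L => [sequence crossing_sum M k n x]_k (L + n)%N))//.
  by rewrite cvg_shiftn; exact: crossing_sum_cvg.
rewrite -(cvg_lim _ cg)//; apply: limr_le; first exact: cvgP cg.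
by apply: nearW => L; rewrite -lee_fin fineK// gl.
Qed.

Definition crossing_total n x : R := \sum_(j < n) ct j%:Z x.

Let F := crossing_total.

(** The correlations exceed [es ^ 2] by a summable amount, so the second moment exceeds
    [n ^ 2 es ^ 2] by [O(n)], and the quadratic terms cancel against the squared mean. *)
Lemma crossing_total_variance : exists2 C, 0 <= C & forall n,
  (\int[P]_x ((F n x - n%:R * es) ^+ 2)%:E <= (C * n%:R)%:E)%E.
Proof.
have [C C0 hC] := crossing_time_correlation.
have rho_itv : 0 <= rho < 1.
  by rewrite rho_lt1 andbT; exact: (rho_ge0 M_gt0 rho_drop).
have [D D0 hD] := sum_poly_geometric_le rho_itv.
have ct0 := crossing_time_ge0; have mct := measurable_crossing_time.
have mF n : measurable_fun setT (F n) by apply: measurable_sum => j; exact: mct.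
have F0 n x : 0 <= F n x by exact: sumr_ge0.
have es0 : 0 <= es.
  by rewrite -lee_fin -esE; exact/ltW/(mean_speed_inv_gt0 M_gt0 iidP).
have IF n : (\int[P]_x (F n x)%:E = (n%:R * es)%:E)%E.
  rewrite integral_EFin_sum//.
  under eq_bigr do rewrite integral_crossing_time.
  by rewrite sumEFin sumr_const card_ord mulr_natl.
have cross n : (\int[P]_x (F n x * ct n%:Z x)%:E <= (n%:R * es ^+ 2 + C * D)%:E)%E.
  under eq_integral do rewrite mulr_suml.
  rewrite integral_EFin_sum => [|j|j x]; last 2 first.
  - exact: measurable_funM.
  - exact: mulr_ge0.
  apply: (@le_trans _ _ (\sum_(j < n) (es ^+ 2 + C *
     ((1 + (n - j)%:R + (n - j)%:R ^+ 2) * rho ^+ (n - j)))%:E)%E).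
    apply: lee_sum => j _; have := hC j (n - j)%N.
    by rewrite subnKC// ltnW.
  rewrite sumEFin lee_fin big_split/= sumr_const card_ord mulr_natl lerD2l.
  rewrite -mulr_sumr ler_wpM2l//.
  rewrite (le_trans _ (hD n.+1))// big_ord_recl ler_wpDl//.
    by rewrite expr0 expr0n/= !addr0 mulr1.
  rewrite -(big_mkord xpredT (fun m => (1 + (n - m)%:R + (n - m)%:R ^+ 2) * rho ^+ (n - m))).
  rewrite big_nat_rev/= add0n big_mkord.
  apply: ler_sum => j _.
  by have -> : (n - (n - j.+1) = j.+1)%N by have := ltn_ord j; lia.
(* Each new summand contributes twice its excess correlation with the earlier ones and once its
   own. *)
pose K := 2 * (C * D) + C.
have K0 : 0 <= K by rewrite /K; nra.
have sq n : (\int[P]_x (F n x ^+ 2)%:E <= (n%:R ^+ 2 * es ^+ 2 + K * n%:R)%:E)%E.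
  elim: n => [|n IHn].
    under eq_integral do rewrite /F /crossing_total big_ord0 expr0n.
    by rewrite integral0 expr0n/= mul0r mulr0 addr0.
  have -> : (\int[P]_x (F n.+1 x ^+ 2)%:E =
     \int[P]_x (F n x ^+ 2 + (2 * (F n x * ct n%:Z x) + ct n%:Z x * ct n%:Z x))%:E)%E.
    apply: eq_integral => x _; rewrite /F /crossing_total big_ord_recr/= -/(F n x).
    by congr (_%:E); ring.
  have mFc : measurable_fun setT (fun x => F n x * ct n%:Z x) by exact: measurable_funM.
  have mcc : measurable_fun setT (fun x => ct n%:Z x * ct n%:Z x) by exact: measurable_funM.
  have m2 : measurable_fun setT (fun x => 2 * (F n x * ct n%:Z x)).
    by apply: measurable_funM.
  rewrite integral_EFinD; last 4 first.
  - exact: measurable_funX.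
  - exact: measurable_funD.
  - by move=> x; exact: sqr_ge0.
  - by move=> x; rewrite addr_ge0 ?mulr_ge0.
  rewrite integral_EFinD//; last 2 first.
  - by move=> x; rewrite !mulr_ge0.
  - by move=> x; rewrite mulr_ge0.
  rewrite integral_EFinZ//; last by move=> x; rewrite mulr_ge0.
  have c1 : (\int[P]_x (ct n%:Z x * ct n%:Z x)%:E <= (es ^+ 2 + C)%:E)%E.
    by have := hC n 0%N; rewrite addn0 expr0 expr0n/= !addr0 !mulr1.
  have -> : n.+1%:R ^+ 2 * es ^+ 2 + K * n.+1%:R = n%:R ^+ 2 * es ^+ 2 + K * n%:R +
     (2 * (n%:R * es ^+ 2 + C * D) + (es ^+ 2 + C)).
    by rewrite -natr1 /K; ring.
  rewrite [leRHS]EFinD; apply: leeD => //; rewrite [leRHS]EFinD; apply: leeD => //.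
  by rewrite [leRHS]EFinM; apply: lee_wpmul2l => //; rewrite lee_fin.
exists K => // n.
have nes0 : 0 <= 2 * (n%:R * es) by rewrite !mulr_ge0.
have msq : measurable_fun setT (fun x => (F n x - n%:R * es) ^+ 2).
  by apply: measurable_funX; exact: measurable_funB.
have m2F : measurable_fun setT (fun x => 2 * (n%:R * es) * F n x).
  exact: measurable_funM.
(* The expansion of the square is written with the cross term moved to the left, so that only
   integrals of nonnegative functions are added. *)
have E : (\int[P]_x ((F n x - n%:R * es) ^+ 2)%:E + (2 * (n%:R * es) * (n%:R * es))%:E =
   \int[P]_x (F n x ^+ 2)%:E + ((n%:R * es) ^+ 2)%:E)%E.
  rewrite [X in (_ + X)%E = _]EFinM -IF -integral_EFinZ//.
  rewrite -integral_EFinD//; last 2 first.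
  - by move=> x; exact: sqr_ge0.
  - by move=> x; rewrite mulr_ge0.
  rewrite -[X in _ = (_ + X)%E](integral_prob_cst P) -integral_EFinD//; last 3 first.
  - exact: measurable_funX.
  - by move=> x; exact: sqr_ge0.
  - by move=> x; exact: sqr_ge0.
  by apply: eq_integral => x _; congr (_%:E); ring.
rewrite -(@leeD2rE _ (2 * (n%:R * es) * (n%:R * es))%:E)// E.
apply: (le_trans (leeD (sq n) (lexx _))); rewrite -!EFinD.
have -> : n%:R ^+ 2 * es ^+ 2 + K * n%:R + (n%:R * es) ^+ 2 =
  K * n%:R + 2 * (n%:R * es) * (n%:R * es) by ring.
by [].
Qed.

Lemma ae_crossing_total_cvg : \forall x \ae P, (F n x / n%:R) @[n --> \oo] --> es.
Proof.
have [C C0 hC] := crossing_total_variance.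
have ct0 := crossing_time_ge0; have mct := measurable_crossing_time.
have mF n : measurable_fun setT (F n) by apply: measurable_sum => j; exact: mct.
pose e k x := F (k.+1 ^ 2)%N x / (k.+1 ^ 2)%:R - es.
have me k : measurable_fun setT (e k).
  by apply: measurable_funB => //; apply: measurable_funM.
pose g n x := \sum_(k < n) e k x ^+ 2.
have mg n : measurable_fun setT (g n).
  by apply: measurable_sum => k; exact: measurable_funX.
have g0 n x : 0 <= g n x by apply: sumr_ge0 => k _; exact: sqr_ge0.
have nd_g x : nondecreasing_seq (g ^~ x).
  by apply/nondecreasing_seqP => n; rewrite /g big_ord_recr lerDl sqr_ge0.
have gC n : (\int[P]_x (g n x)%:E <= (C * 2)%:E)%E.
  rewrite integral_EFin_sum => [|k|k x]; last 2 first.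
  - exact: measurable_funX.
  - exact: sqr_ge0.
  apply: (@le_trans _ _ (\sum_(k < n) (C * (k.+1%:R ^+ 2)^-1)%:E)%E); last first.
    by rewrite sumEFin lee_fin -mulr_sumr ler_wpM2l// sum_inv_sqr_le.
  apply: lee_sum => k _; set N := (k.+1 ^ 2)%N.
  have N0 : 0 < N%:R :> R by rewrite ltr0n expn_gt0.
  have -> : (\int[P]_x (e k x ^+ 2)%:E =
      \int[P]_x ((N%:R ^+ 2)^-1 * (F N x - N%:R * es) ^+ 2)%:E)%E.
    apply: eq_integral => x _; rewrite /e -/N; congr (_%:E).
    by field; rewrite gt_eqF.
  rewrite integral_EFinZ; last 3 first.
  - by apply: measurable_funX; exact: measurable_funB.
  - by move=> x; exact: sqr_ge0.
  - by rewrite invr_ge0 sqr_ge0.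
  apply: (@le_trans _ _ (((N%:R ^+ 2)^-1)%:E * (C * N%:R)%:E)%E).
    by apply: lee_wpmul2l; [rewrite lee_fin invr_ge0 sqr_ge0|exact: hC].
  rewrite -EFinM lee_fin.
  have -> : (N%:R ^+ 2)^-1 * (C * N%:R) = C * N%:R^-1 by field; rewrite gt_eqF.
  by rewrite /N natrX.
have := ae_bounded_nd mg g0 nd_g gC.
apply: filterS => x [B hB].
apply: cvg_div_of_squares.
- by move=> n; exact: sumr_ge0.
- by apply/nondecreasing_seqP => n; rewrite /F /crossing_total big_ord_recr lerDl.
- apply/subr_cvg0.
  have e0 : e k x ^+ 2 @[k --> \oo] --> (0 : R).
    by apply: (@cvg0_of_bounded_sum _ _ B) => // k; exact: sqr_ge0.
  have n0 : `|e k x| @[k --> \oo] --> (0 : R).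
    have -> : (fun k => `|e k x|) = (fun k => Num.sqrt (e k x ^+ 2)).
      by apply/funext => k; rewrite sqrtr_sqr.
    rewrite -[X in _ --> X](@sqrtr0 R).
    by apply: (cvg_comp _ _ e0); exact: sqrt_continuous.
  exact/norm_cvg0P.
Qed.

End LawOfLargeNumbers.

(** * Nearest-neighbour chains *)

Lemma ae_forall_int d (T : measurableType d) (R : realType)
    (Q : {measure set T -> \bar R}) (A : int -> T -> Prop) :
  (forall i, \forall t \ae Q, A i t) -> \forall t \ae Q, forall i, A i t.
Proof.
move=> hA.
have := @ae_foralln _ _ _ Q (fun n t => A (odflt 0 (unpickle n)) t) (fun n => hA _).
by apply: filterS => t h i; have := h (pickle i); rewrite pickleK.
Qed.

Section IntegerVariable.
Context d (T : measurableType d) (R : realType) (Q : {measure set T -> \bar R}).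
Variable Y : T -> int.
Hypothesis mY : forall i, measurable (Y @^-1` [set i]).

Lemma measurable_int_preimage (A : set int) : measurable (Y @^-1` A).
Proof.
have -> : Y @^-1` A = \bigcup_n (Y @^-1` [set j | pickle j = n /\ A j]).
  apply/seteqP; split=> t /=; first by move=> At; exists (pickle (Y t)).
  by move=> [n _] [].
apply: bigcup_measurable => n _.
have [[j [jn Aj]]|nj] := pselect (exists j : int, pickle j = n /\ A j).
  have -> : [set j | pickle j = n /\ A j] = [set j] => //.
  apply/seteqP; split=> i /=; last by move=> ->.
  by rewrite -jn => -[/(pcan_inj pickleK) ->].
have -> : [set j | pickle j = n /\ A j] = set0.
  by apply/seteqP; split=> i //= hi; case: nj; exists i.
by rewrite preimage_set0.
Qed.

Lemma measurable_fun_int (G : int -> R) : measurable_fun setT (fun t => G (Y t)).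
Proof.
by move=> _ A mA; rewrite setTI; exact: (measurable_int_preimage (G @^-1` A)).
Qed.

Let cell n : set T := Y @^-1` [set j | pickle j = n].

Let cellE n : (exists j, cell n = Y @^-1` [set j]) \/ cell n = set0.
Proof.
have [[j jn]|nj] := pselect (exists j : int, pickle j = n).
  left; exists j; apply/seteqP; split=> t /=; last by rewrite /cell /= => ->.
  by rewrite /cell /= -jn => /(pcan_inj pickleK).
by right; apply/seteqP; split=> t //= ht; apply: nj; exists (Y t).
Qed.

Let mcell n : measurable (cell n). Proof. exact: measurable_int_preimage. Qed.

Let bigcup_cell : \bigcup_n cell n = setT.
Proof. by apply/seteqP; split=> t // _; exists (pickle (Y t)). Qed.

Let tcell : trivIset setT cell.
Proof.
apply/trivIsetP => i j _ _ ij; apply/seteqP; split=> t //= [hi hj].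
by move/eqP: ij; rewrite -hi -hj.
Qed.

Lemma integral_int_partition (f g : T -> R) :
  measurable_fun setT f -> measurable_fun setT g ->
  (forall t, 0 <= f t) -> (forall t, 0 <= g t) ->
  (forall i, \int[Q]_(t in Y @^-1` [set i]) (f t)%:E =
             \int[Q]_(t in Y @^-1` [set i]) (g t)%:E)%E ->
  (\int[Q]_t (f t)%:E = \int[Q]_t (g t)%:E)%E.
Proof.
move=> mf mg f0 g0 fg.
have E (h : T -> R) : measurable_fun setT h -> (forall t, 0 <= h t) ->
    (\int[Q]_t (h t)%:E = \sum_(n <oo) \int[Q]_(t in cell n) (h t)%:E)%E.
  move=> mh h0; rewrite -{1}bigcup_cell ge0_integral_bigcup//.
  - by rewrite bigcup_cell; exact/measurable_EFinP.
  - by move=> t _; rewrite lee_fin.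
rewrite !E//; apply: eq_eseriesr => n _.
by have [[j ->]|->] := cellE n; rewrite ?integral_set0.
Qed.

Lemma measure_int_partition (A B : set T) (c : R) : 0 <= c ->
  measurable A -> measurable B ->
  (forall i, Q (A `&` Y @^-1` [set i]) = Q (B `&` Y @^-1` [set i]) * c%:E)%E ->
  (Q A = Q B * c%:E)%E.
Proof.
move=> c0 mA mB AB.
have E C : measurable C -> (Q C = \sum_(n <oo) Q (C `&` cell n))%E.
  move=> mC; rewrite -{1}(setIT C) -bigcup_cell setI_bigcupr measure_bigcup//.
  - by apply: eq_eseriesl => n; rewrite in_setT.
  - by move=> n _; exact: measurableI.
  - by apply: trivIset_setIl.
rewrite (E A)// (E B)// muleC -nneseriesZl//.
apply: eq_eseriesr => n _; have [[j ->]|->] := cellE n; first by rewrite muleC.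
by rewrite !setI0 !measure0 mule0.
Qed.

End IntegerVariable.

Section NearestNeighbourChain.
Context d (T : measurableType d) (R : realType) (Q : probability T R).
Variables (p : int -> int -> R) (k : int) (X : nat -> T -> int).
Hypothesis chainX : markov_chain Q p k X.
Hypothesis p_ge0 : forall i j, 0 <= p i j.
Hypothesis p_near : forall i j, (1 < `|i - j|)%N -> p i j = 0.

Let mX n i : measurable (X n @^-1` [set i]).
Proof. by have [] := chainX. Qed.

Let hist m n (x : nat -> int) := [set t | forall l, (m <= l <= n)%N -> X l t = x l].

Let measurable_hist m n x : measurable (hist m n x).
Proof.
have -> : hist m n x = \bigcap_l (if (m <= l <= n)%N then X l @^-1` [set x l] else setT).
  apply/seteqP; split=> t h l /=.
    by move=> _; case: ifP => // hl; exact: h.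
  by move=> hl; have := h l I; rewrite hl.
by apply: bigcapT_measurable => l; case: ifP.
Qed.

(** The start [m] of the observation window moves forward one step at a time: summing over the value
    of [X m] forgets it. The case [m = 0] is the definition of the chain, and [m = n] gives the
    one-step law. *)
Let hist_step m n x : (m <= n)%N ->
  (Q (hist m n.+1 x) = Q (hist m n x) * (p (x n) (x n.+1))%:E)%E.
Proof.
elim: m x => [|m IHm] x mn.
  have [_ _ h] := chainX; have := h n x.
  have -> : [set t | forall l, (l <= n.+1)%N -> X l t = x l] = hist 0 n.+1 x by [].
  by have -> : [set t | forall l, (l <= n)%N -> X l t = x l] = hist 0 n x by [].
apply: (measure_int_partition (mX m)) => // i.
pose y l := if l == m then i else x l.
have yE l : (m < l)%N -> y l = x l by rewrite /y; case: eqP => // -> ; rewrite ltnn.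
have hE n' : hist m.+1 n' x `&` X m @^-1` [set i] = hist m n' y \/ (n' < m)%N.
  have [h|h] := ltnP n' m; [by right|left].
  apply/seteqP; split=> t /=.
    move=> [ht Xi] l /andP[l1 l2]; rewrite /y; case: eqP => [->//|/eqP lm].
    by apply: ht; rewrite l2 andbT ltn_neqAle eq_sym lm.
  move=> ht; split.
    by move=> l /andP[l1 l2]; rewrite -yE// ht// (ltnW l1) l2.
  by have := ht m; rewrite leqnn h /y eqxx; apply.
case: (hE n.+1) => [->|]; last by lia.
case: (hE n) => [->|]; last by lia.
by rewrite [LHS](IHm y (ltnW mn)) !yE// ltnS ltnW.
Qed.

Lemma markov_one_step n i j :
  (Q (X n @^-1` [set i] `&` X n.+1 @^-1` [set j]) =
   Q (X n @^-1` [set i]) * (p i j)%:E)%E.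
Proof.
pose x l := if l == n then i else j.
have := @hist_step n n x (leqnn n).
have -> : hist n n.+1 x = X n @^-1` [set i] `&` X n.+1 @^-1` [set j].
  apply/seteqP; split=> t /=.
    move=> h; split; first by rewrite h ?leqnn ?leqnSn// /x eqxx.
    rewrite h ?leqnn ?leqnSn// /x.
    by have -> : (n.+1 == n) = false by lia.
  move=> [hi hj] l hl; rewrite /x; have [->//|ln] := eqVneq l n.
  by have -> : l = n.+1 by lia.
have -> : hist n n x = X n @^-1` [set i].
  apply/seteqP; split=> t /=; first by move=> /(_ n); rewrite leqnn /x eqxx; apply.
  by move=> h l; rewrite -eqn_leq => /eqP <-; rewrite /x eqxx.
by rewrite /x eqxx; have -> : (n.+1 == n) = false by lia.
Qed.

Lemma ae_step_near : \forall t \ae Q, forall n, (`|X n t - X n.+1 t| <= 1)%N.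
Proof.
apply/ae_foralln => n.
have : \forall t \ae Q, forall i j, X n t = i -> X n.+1 t = j -> (`|i - j| <= 1)%N.
  apply: ae_forall_int => i; apply: ae_forall_int => j.
  have [ij|ij] := leqP `|i - j|%N 1; first exact: aeW.
  exists (X n @^-1` [set i] `&` X n.+1 @^-1` [set j]); split.
  - exact: measurableI.
  - by rewrite [LHS]markov_one_step p_near// mule0.
  - by move=> t /= /not_implyP[-> /not_implyP[-> _]].
by apply: filterS => t h; exact: h.
Qed.

Lemma ae_start : \forall t \ae Q, X 0%N t = k.
Proof.
have [_ h _] := chainX.
exists (~` (X 0%N @^-1` [set k])); split=> //; first exact: measurableC.
by rewrite [LHS]probability_setC// h subee.
Qed.

Lemma ae_range : \forall t \ae Q, forall n, (`|X n t| <= `|k| + n)%N.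
Proof.
have := ae_step_near; have := ae_start; apply: filterS2 => t h0 hs n.
by elim: n => [|n IHn]; [rewrite h0; lia|have := hs n; lia].
Qed.

Definition chain_step (G : int -> R) i : R :=
  p i (i + 1) * G (i + 1) + p i i * G i + p i (i - 1) * G (i - 1).

(** On each fibre [X n = i] the function [G (X n.+1)] is almost surely a combination of three
    indicators, as steps are at most one. Both sides may be infinite, so only [G >= 0] is
    required. *)
Lemma integral_chain_step n (G : int -> R) : (forall i, 0 <= G i) ->
  (\int[Q]_t (G (X n.+1 t))%:E = \int[Q]_t (chain_step G (X n t))%:E)%E.
Proof.
move=> G0.
have pG0 i : 0 <= chain_step G i by rewrite !addr_ge0 ?mulr_ge0.
have mGX m (H : int -> R) : measurable_fun setT (fun t => H (X m t)).
  exact: (measurable_fun_int (mX m)).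
apply: (integral_int_partition (mX n)) => // i.
set A := X n @^-1` [set i]; have mA : measurable A by exact: mX.
pose ind j t : R := (X n.+1 t == j)%:R.
have mind j : measurable_fun setT (ind j).
  exact: (mGX n.+1 (fun z => (z == j)%:R)).
have ind0 j t : 0 <= ind j t by [].
have mt j : measurable_fun A (fun t => (G j * ind j t)%:E).
  by apply: measurable_funTS; apply/measurable_EFinP; exact: measurable_funM.
have t0 j t : (0 <= (G j * ind j t)%:E)%E by rewrite lee_fin mulr_ge0.
transitivity (\int[Q]_(t in A) ((G (i + 1) * ind (i + 1) t)%:E + (G i * ind i t)%:E
    + (G (i - 1) * ind (i - 1) t)%:E))%E.
  apply: ge0_ae_eq_integral => //.
  - by apply: measurable_funTS; apply/measurable_EFinP; exact: mGX.
  - by apply: emeasurable_funD => //; exact: emeasurable_funD.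
  - by move=> t _; rewrite lee_fin.
  - by move=> t _; rewrite !adde_ge0.
  have := ae_step_near; apply: filterS => t /(_ n) hs; rewrite /A /= => At.
  rewrite -!EFinD /ind; congr (_%:E).
  have [|[|]] : X n.+1 t = i + 1 \/ X n.+1 t = i \/ X n.+1 t = i - 1 by lia.
  - move=> ->; rewrite eqxx; have -> : (i + 1 == i) = false by lia.
    have -> : (i + 1 == i - 1) = false by lia.
    by rewrite !mulr0 !addr0 mulr1.
  - move=> ->; rewrite eqxx; have -> : (i == i + 1) = false by lia.
    have -> : (i == i - 1) = false by lia.
    by rewrite !mulr0 addr0 add0r mulr1.
  - move=> ->; rewrite eqxx; have -> : (i - 1 == i + 1) = false by lia.
    have -> : (i - 1 == i) = false by lia.
    by rewrite !mulr0 !add0r mulr1.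
have iE j : (\int[Q]_(t in A) (G j * ind j t)%:E = (Q A * (p i j * G j)%:E))%E.
  transitivity (\int[Q]_(t in A) ((G j)%:E * (\1_(X n.+1 @^-1` [set j]) t)%:E))%E.
    apply: eq_integral => t _; rewrite -EFinM indicE /ind; congr ((_ * (nat_of_bool _)%:R)%:E).
    by apply/eqP/idP; rewrite inE.
  rewrite ge0_integralZl_EFin//.
  - by rewrite integral_indic// setIC [X in (_ * X)%E]markov_one_step muleC [in RHS]EFinM muleA.
  by apply/measurable_EFinP; apply: measurable_funTS; exact: measurable_indic.
rewrite ge0_integralD//; last 2 first.
- by move=> t _; rewrite adde_ge0.
- exact: emeasurable_funD.
rewrite ge0_integralD// !iE.
transitivity (\int[Q]_(t in A) (chain_step G i)%:E)%E; last first.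
  by apply: eq_integral => t; rewrite inE /A /= => ->.
have pj0 j : (0 <= (p i j * G j)%:E)%E by rewrite lee_fin mulr_ge0.
by rewrite integral_cst// [RHS]muleC /chain_step !EFinD !ge0_muleDr ?adde_ge0.
Qed.

End NearestNeighbourChain.

Section IntegerSequences.
Variable R : realType.
Implicit Types z : nat -> int.

Lemma int_cvg_pinftyP z : ((z n)%:~R : R) @[n --> \oo] --> +oo <->
  forall m : nat, \forall n \near \oo, m%:Z <= z n.
Proof.
split=> [/cvgryPge h m|h].
  have := h m%:R; apply: filterS => n.
  by rewrite -[m%:R]/((m%:Z)%:~R) ler_int.
apply/cvgryPge => A; have := h (Num.bound A); apply: filterS => n hn.
apply: (@le_trans _ _ ((Num.bound A)%:Z)%:~R); last by rewrite ler_int.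
have [A0|A0] := leP 0 A; first by rewrite ltW// archi_boundP.
by rewrite (le_trans (ltW A0))// ler0z.
Qed.

Lemma int_cvg_ninftyP z : ((z n)%:~R : R) @[n --> \oo] --> -oo <->
  ((- z n)%:~R : R) @[n --> \oo] --> +oo.
Proof.
have -> : (fun n => (- z n)%:~R : R) = (fun n => - (z n)%:~R).
  by apply/funext => n; rewrite mulrNz.
by split=> [/cvgNry//|]; rewrite cvgNry.
Qed.

(** Unit steps cannot jump over [0], so the sign is constant after [N]. Then, inductively,
    eventually [z >= m] and [z != m] give [z >= m + 1]. *)
Lemma int_steps_positive z :
  (forall n, (`|z n - z n.+1| <= 1)%N) -> (forall i, \forall n \near \oo, z n != i) ->
  forall N, (forall n, (N <= n)%N -> z n != 0) -> 0 < z N ->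
  ((z n)%:~R : R) @[n --> \oo] --> +oo.
Proof.
move=> zs zi N zN zN0; apply/int_cvg_pinftyP.
have pos n : (N <= n)%N -> 0 < z n.
  elim: n => [|n IHn]; first by rewrite leqn0 => /eqP N0; rewrite -N0.
  rewrite leq_eqVlt => /orP[/eqP <-//|Nn].
  by have := IHn Nn; have := zs n; have := zN n.+1 (leqW Nn); lia.
elim=> [|m IHm].
  by exists N => // n /= Nn; apply: ltW; exact: pos.
have := zi m%:Z; move: IHm; apply: filterS2 => n h1 h2; lia.
Qed.

Lemma int_steps_escape z :
  (forall n, (`|z n - z n.+1| <= 1)%N) -> (forall i, \forall n \near \oo, z n != i) ->
  ((z n)%:~R : R) @[n --> \oo] --> +oo \/ ((z n)%:~R : R) @[n --> \oo] --> -oo.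
Proof.
move=> zs zi; have [N _ hN] := zi 0.
have [zN|zN] := leP (z N) 0; [right|left].
  apply/int_cvg_ninftyP; apply: (@int_steps_positive (fun n => - z n)) => //.
  - by move=> n; have := zs n; lia.
  - by move=> i; have := zi (- i); apply: filterS => n; lia.
  - by move=> n Nn; have := hN n Nn => /=; lia.
  - by have := hN N (leqnn N) => /=; lia.
by apply: (int_steps_positive zs zi _ zN) => n Nn; exact: hN.
Qed.

End IntegerSequences.

Section Escape.
Context d (T : measurableType d) (R : realType) (Q : probability T R).
Variables (p : int -> int -> R) (k : int) (X : nat -> T -> int).
Hypothesis chainX : markov_chain Q p k X.
Hypothesis p_ge0 : forall i j, 0 <= p i j.
Hypothesis p_near : forall i j, (1 < `|i - j|)%N -> p i j = 0.

Let mX n i : measurable (X n @^-1` [set i]).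
Proof. by have [] := chainX. Qed.

Let mGX m (H : int -> R) : measurable_fun setT (fun t => H (X m t)).
Proof. exact: (measurable_fun_int (mX m)). Qed.

Lemma integral_start (G : int -> R) : (forall i, 0 <= G i) ->
  (\int[Q]_t (G (X 0%N t))%:E = (G k)%:E)%E.
Proof.
move=> G0; rewrite -(integral_prob_cst Q (G k)); apply: ge0_ae_eq_integral => //.
- by apply/measurable_EFinP; exact: mGX.
- by move=> t _; rewrite lee_fin.
- by move=> t _; rewrite lee_fin.
- by have := ae_start chainX; apply: filterS => t -> _.
Qed.

(** The pointwise inequality is asked only on the sites reachable by time [n]; the growing bounds on
    the increments can therefore be used. *)
Lemma integral_chain_step_le n (G H : int -> R) :
  (forall i, 0 <= G i) -> (forall i, 0 <= H i) ->
  (forall i, (`|i| <= `|k| + n)%N -> chain_step p G i <= H i) ->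
  (\int[Q]_t (G (X n.+1 t))%:E <= \int[Q]_t (H (X n t))%:E)%E.
Proof.
move=> G0 H0 GH; rewrite (integral_chain_step chainX p_ge0 p_near)//.
apply: ae_ge0_le_integral => //.
- by move=> t _; rewrite lee_fin !addr_ge0 ?mulr_ge0.
- by apply/measurable_EFinP; exact: (mGX n (chain_step p G)).
- by move=> t _; rewrite lee_fin.
- by apply/measurable_EFinP; exact: mGX.
- have := ae_range chainX p_ge0 p_near; apply: filterS => t /(_ n) ht _.
  by rewrite lee_fin GH.
Qed.

Lemma ae_leaves_site (G : int -> R) (c : R) (i0 : int) :
  (forall i, 0 <= G i) -> 0 < c ->
  (forall i, chain_step p G i + c * (i == i0)%:R <= G i) ->
  \forall t \ae Q, \forall n \near \oo, X n t != i0.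
Proof.
move=> G0 c0 hG.
pose v (i : int) : R := c * (i == i0)%:R.
have v0 i : 0 <= v i by rewrite mulr_ge0 ?(ltW c0).
pose g n t := \sum_(m < n) v (X m t).
have mg n : measurable_fun setT (g n).
  by apply: measurable_sum => m; exact: mGX.
have g0 n t : 0 <= g n t by exact: sumr_ge0.
have nd_g t : nondecreasing_seq (g ^~ t).
  by apply/nondecreasing_seqP => n; rewrite /g big_ord_recr lerDl.
have step0 i : 0 <= chain_step p G i by rewrite !addr_ge0 ?mulr_ge0.
(* The supermartingale balance: the accumulated defect plus the remaining mean of [G] never exceeds
   the initial value. *)
have hn n : (\int[Q]_t (g n t)%:E + \int[Q]_t (G (X n t))%:E <= (G k)%:E)%E.
  elim: n => [|n IHn].
    rewrite integral_start//; under eq_integral do rewrite /g big_ord0.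
    by rewrite integral0 add0e.
  apply: le_trans IHn.
  have -> : (\int[Q]_t (g n.+1 t)%:E = \int[Q]_t (g n t)%:E + \int[Q]_t (v (X n t))%:E)%E.
    rewrite -(integral_EFinD Q (mg n) (mGX n v) (g0 n) (fun t => v0 _)).
    by apply: eq_integral => t _; rewrite /g big_ord_recr.
  rewrite -addeA; apply: leeD2l.
  rewrite (integral_chain_step chainX p_ge0 p_near)//.
  rewrite -(integral_EFinD Q (mGX n v) (mGX n (chain_step p G)) (fun t => v0 _)
    (fun t => step0 _)).
  apply: integral_EFin_le.
  - by apply: measurable_funD; [exact: mGX|exact: (mGX n (chain_step p G))].
  - exact: mGX.
  - by move=> t; rewrite addr_ge0//= addrC hG.
have gC n : (\int[Q]_t (g n t)%:E <= (G k)%:E)%E.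
  by apply: le_trans (hn n); rewrite leeDl// integral_ge0// => t _; rewrite lee_fin.
have := ae_bounded_nd mg g0 nd_g gC; apply: filterS => t [B hB].
(* A sequence with values [0] and [c] tending to [0] is eventually [0]. *)
have v_cvg : v (X n t) @[n --> \oo] --> (0 : R).
  by apply: (@cvg0_of_bounded_sum _ _ B) => // n; exact: v0.
have h : \forall n \near \oo, v (X n t) < c by exact: (cvgr_lt 0 v_cvg).
apply: filterS h => n; rewrite /v.
by case: eqP => //= _; rewrite mulr1 ltxx.
Qed.

Lemma ae_escape : (forall i, \forall t \ae Q, \forall n \near \oo, X n t != i) ->
  \forall t \ae Q, to_pinfty R X t \/ to_ninfty R X t.
Proof.
move=> h; have := ae_forall_int h; have := ae_step_near chainX p_ge0 p_near.
by apply: filterS2 => t h1 h2; exact: int_steps_escape.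
Qed.

(** Used with [s = 1] and [s = -1], for the two ends of the line. *)
Let measurable_near_ge (s : int) (m : nat) :
  measurable [set t | \forall n \near \oo, m%:Z <= s * X n t].
Proof.
have -> : [set t | \forall n \near \oo, m%:Z <= s * X n t] =
    \bigcup_N \bigcap_n (if (N <= n)%N then X n @^-1` [set i | m%:Z <= s * i] else setT).
  apply/seteqP; split=> t /=.
    by move=> [N _ h]; exists N => // n _; case: ifP => // Nn; exact: h.
  move=> [N _ h]; exists N => // n /= Nn.
  by have := h n I; rewrite Nn.
apply: bigcup_measurable => N _; apply: bigcapT_measurable => n.
by case: ifP => // _; exact: (measurable_int_preimage (mX n)).
Qed.

Lemma measurable_to_pinfty : measurable (to_pinfty R X).
Proof.
have -> : to_pinfty R X = \bigcap_m [set t | \forall n \near \oo, m%:Z <= 1 * X n t].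
  apply/seteqP; split=> t.
    by move=> /int_cvg_pinftyP h m _; have := h m; apply: filterS => n; rewrite mul1r.
  move=> h; apply/int_cvg_pinftyP => m; have := h m I.
  by apply: filterS => n; rewrite mul1r.
by apply: bigcapT_measurable => m; exact: measurable_near_ge.
Qed.

Lemma measurable_to_ninfty : measurable (to_ninfty R X).
Proof.
have -> : to_ninfty R X = \bigcap_m [set t | \forall n \near \oo, m%:Z <= -1 * X n t].
  apply/seteqP; split=> t.
    move=> /int_cvg_ninftyP/int_cvg_pinftyP h m _; have := h m.
    by apply: filterS => n; rewrite mulN1r.
  move=> h; apply/int_cvg_ninftyP/int_cvg_pinftyP => m; have := h m I.
  by apply: filterS => n; rewrite mulN1r.
by apply: bigcapT_measurable => m; exact: measurable_near_ge.
Qed.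

Lemma escape_probability :
  (\forall t \ae Q, to_pinfty R X t \/ to_ninfty R X t) ->
  (Q (to_pinfty R X) + Q (to_ninfty R X) = 1)%E.
Proof.
move=> h; set U := to_pinfty R X `|` to_ninfty R X.
have mU : measurable U.
  by apply: measurableU; [exact: measurable_to_pinfty|exact: measurable_to_ninfty].
have QU : Q (~` U) = 0%E.
  move: h => [N [mN QN hN]].
  apply/eqP; rewrite eq_le measure_ge0 andbT -QN le_measure ?inE//.
  exact: measurableC.
rewrite -measureU//.
- rewrite -[LHS]/(Q U) -(setCK U).
  have -> : Q (~` ~` U) = (1 - Q (~` U))%E by apply: probability_setC; exact: measurableC.
  by rewrite QU sube0.
- exact: measurable_to_pinfty.
- exact: measurable_to_ninfty.
- apply/seteqP; split=> t //= [].
  move=> /int_cvg_pinftyP/(_ 1%N) h1 /int_cvg_ninftyP/int_cvg_pinftyP/(_ 1%N) h2.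
  by have [n [a b]] := filter_ex (filterI h1 h2); lia.
Qed.

End Escape.

(** * Quenched transience and speed *)

Section GreenLimit.
Variables (R : realType) (M : R) (w : int -> R).
Hypothesis w_itv : forall i, 0 <= w i <= M.
Variable C : R.
Hypothesis growth : forall L i,
  green_sum M w L i ^+ 12 <= C * (1 + `|i|%N%:R) ^+ 2.

Definition green i : R := limn (fun L => green_sum M w L i).

Let C_ge0 : 0 <= C.
Proof. by have := growth 0 0; rewrite /= expr0n/= addr0 expr1n mulr1. Qed.

Let gs0 L i : 0 <= green_sum M w L i.
Proof. by have /andP[] := green_sum_itv w_itv L i. Qed.

Lemma green_cvg i : green_sum M w L i @[L --> \oo] --> green i.
Proof.
apply: nondecreasing_is_cvgn; first exact: green_sum_nd.
exists (1 + C * (1 + `|i|%N%:R) ^+ 2) => _ [L _ <-].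
apply: le_trans (_ : 1 + green_sum M w L i ^+ 12 <= _); last by rewrite lerD2l.
have [h|h] := leP (green_sum M w L i) 1; first by rewrite ler_wpDr// exprn_ge0.
by rewrite ler_wpDl// -{1}[green_sum _ _ _ _]expr1 ler_eXn2l.
Qed.

Lemma green_sum_le_green L i : green_sum M w L i <= green i.
Proof.
apply: nondecreasing_cvgn_le; first exact: green_sum_nd.
exact: cvgP (@green_cvg i).
Qed.

Lemma green_ge1 i : 1 <= green i.
Proof.
by apply: le_trans (green_sum_le_green 1 i); rewrite /= mulr0 addr0.
Qed.

Lemma greenS i : green (i + 1) = 1 + beta M w i ^+ 2 * green i.
Proof.
apply/cvg_lim => //; rewrite -(cvg_shiftS _) /= addrK.
apply: cvgD; first exact: cvg_cst.
by apply: cvgM; [exact: cvg_cst|exact: green_cvg].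
Qed.

Lemma green_growth i : green i ^+ 12 <= C * (1 + `|i|%N%:R) ^+ 2.
Proof.
have h : green_sum M w L i ^+ 12 @[L --> \oo] --> green i ^+ 12.
  exact: (@continuous_cvg _ _ _ _ _ (fun L => green_sum M w L i)
    (fun z : R => z ^+ 12) (green i) (@exprn_continuous R 12 (green i)) (@green_cvg i)).
rewrite -(cvg_lim _ h)//; apply: limr_le; first exact: cvgP h.
by apply: nearW => L; exact: growth.
Qed.

(* If [beta i = 1] then all fractions to the left of [i] equal [1] and the
   series defining [green] diverges. *)
Lemma beta_lt1 i : beta M w i < 1.
Proof.
rewrite lt_neqAle beta_le1// andbT; apply/eqP => bi.
have b1 n : beta M w (i - n%:Z) = 1.
  elim: n => [|n IHn]; first by rewrite subr0.
  have -> : i - n.+1%:Z = i - n%:Z - 1 by lia.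
  exact: beta_eq1.
have gL L m : (forall n : nat, beta M w (m - 1 - n%:Z) = 1) -> green_sum M w L m = L%:R.
  elim: L m => //= L IHL m hm; rewrite IHL.
    have := hm 0%N; rewrite subr0 => ->; rewrite expr1n mul1r.
    by rewrite -[in RHS]natr1 addrC.
  by move=> n; have -> : m - 1 - 1 - n%:Z = m - 1 - n.+1%:Z by lia.
have := green_sum_le_green (Num.bound (green (i + 1))) (i + 1).
rewrite gL; last by move=> n; rewrite addrK.
by rewrite leNgt archi_boundP// (le_trans ler01 (green_ge1 _)).
Qed.

Definition site_time i : R := lambda M * (beta M w i * green i).

Let lam_gt0 : 0 < lambda M := lambda_gt0 w_itv.

Lemma site_time_gt0 i : 0 < site_time i.
Proof. by rewrite !mulr_gt0 ?beta_gt0// (lt_le_trans ltr01 (green_ge1 i)). Qed.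

Lemma site_time_le i : site_time i <= lambda M * green i.
Proof.
rewrite ler_pM2l// ler_piMl ?beta_le1//.
exact: le_trans ler01 (green_ge1 i).
Qed.

(* Mean displacement one in the additive coordinate whose increments are the
   [site_time i], under the transition probabilities [1 / (lambda beta_i)],
   [w_i / lambda], [beta_{i-1} / lambda]. *)
Lemma site_time_drift i :
  (beta M w i)^-1 * site_time i - beta M w (i - 1) * site_time (i - 1) = lambda M.
Proof.
have := greenS (i - 1); rewrite subrK /site_time => ->.
by field; rewrite gt_eqF// beta_gt0.
Qed.

(** Dominates the absolute increments of [f (X n) - n] from site [i], namely [S i - 1], [-1] and
    [- S (i - 1) - 1]. *)
Definition jump_bound i : R := 1 + site_time i + site_time (i - 1).

Lemma jump_bound_ge0 i : 0 <= jump_bound i.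
Proof. by rewrite /jump_bound !addr_ge0// ltW// site_time_gt0. Qed.

(** The bound is compared after squaring, where it reduces to the quadratic growth of the twelfth
    power of [green] at [i] and [i - 1]. *)
Lemma jump_bound_growth : exists2 D, 0 <= D &
  forall i, jump_bound i ^+ 6 <= D * (2 + `|i|%N%:R).
Proof.
exists ((1 + 2 * lambda M) ^+ 6 * (1 + 2 * C)).
  by rewrite mulr_ge0 ?exprn_ge0// addr_ge0 ?mulr_ge0// ltW.
move=> i; set D := (1 + 2 * lambda M) ^+ 6 * (1 + 2 * C).
have l0 := ltW lam_gt0.
pose g := Num.max (green i) (green (i - 1)).
have g1 : 1 <= g by rewrite le_max green_ge1.
have g0 := le_trans ler01 g1.
have jg : jump_bound i <= (1 + 2 * lambda M) * g.
  have gi : green i <= g by rewrite le_max lexx.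
  have gi' : green (i - 1) <= g by rewrite le_max lexx orbT.
  have := site_time_le i; have := site_time_le (i - 1); rewrite /jump_bound.
  have := ler_wpM2l l0 gi; have := ler_wpM2l l0 gi'; nra.
have gg : g ^+ 12 <= (1 + 2 * C) * (2 + `|i|%N%:R) ^+ 2.
  have a0 : 0 <= `|i|%N%:R :> R by [].
  set a : R := `|i|%N%:R in a0 *.
  have sq2 : 0 <= (2 + a) ^+ 2 by exact: sqr_ge0.
  have Cle : C * (2 + a) ^+ 2 <= (1 + 2 * C) * (2 + a) ^+ 2.
    by rewrite ler_wpM2r//; have := C_ge0; lra.
  apply: le_trans Cle; rewrite /g; case: (leP (green i) (green (i - 1))) => _.
    apply: le_trans (green_growth (i - 1)) _; rewrite ler_wpM2l//.
    apply: lerXn2r; rewrite ?nnegrE ?addr_ge0//.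
    have -> : 2 + a = 1 + (`|i|%N + 1)%:R by rewrite natrD /a; ring.
    by rewrite lerD2l ler_nat; lia.
  apply: le_trans (green_growth i) _; rewrite ler_wpM2l//.
  by apply: lerXn2r; rewrite ?nnegrE ?addr_ge0// /a; lra.
have D0 : 0 <= D * (2 + `|i|%N%:R).
  by rewrite !mulr_ge0 ?exprn_ge0 ?addr_ge0 ?mulr_ge0.
rewrite -(@ler_pXn2r _ 2)// ?nnegrE ?exprn_ge0 ?jump_bound_ge0//.
rewrite -exprM (le_trans (lerXn2r 12 _ _ jg)) ?nnegrE ?jump_bound_ge0//.
  by rewrite mulr_ge0// addr_ge0 ?mulr_ge0.
have -> : (D * (2 + `|i|%N%:R)) ^+ 2 = (1 + 2 * lambda M) ^+ 12 *
  ((1 + 2 * C) ^+ 2 * (2 + `|i|%N%:R) ^+ 2) by rewrite /D; ring.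
rewrite [leLHS]exprMn.
apply: ler_wpM2l; first by rewrite exprn_ge0// addr_ge0 ?mulr_ge0.
apply: (le_trans gg); rewrite ler_wpM2r ?sqr_ge0//.
by have := C_ge0; nra.
Qed.

End GreenLimit.

(** Choosing a site that attains the maximum makes the bound [B] a value of the squared
    [jump_bound], so [B ^ 3] is a sixth power controlled at that site. *)
Lemma finite_max_int (R : realType) (b : int -> R) (N : nat) :
  exists2 i, (`|i| <= N)%N & forall j, (`|j| <= N)%N -> b j <= b i.
Proof.
elim: N => [|N [i iN hi]].
  exists 0 => // j; rewrite leqn0 absz_eq0 => /eqP ->; exact: lexx.
pose m := if b N.+1%:Z <= b (- N.+1%:Z) then - N.+1%:Z else N.+1%:Z.
have hm j : (`|j| = N.+1)%N -> b j <= b m.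
  move=> jN; have [->|->] : j = N.+1%:Z \/ j = - N.+1%:Z by lia.
    by rewrite /m; case: (leP (b N.+1%:Z) (b (- N.+1%:Z))).
  by rewrite /m; case: (leP (b N.+1%:Z) (b (- N.+1%:Z))) => // /ltW.
have mN : (`|m| = N.+1)%N by rewrite /m; case: ifP; lia.
have [bim|bmi] := leP (b i) (b m).
  exists m; first by rewrite mN.
  move=> j; rewrite leq_eqVlt => /orP[/eqP /hm//|jN].
  by rewrite (le_trans _ bim)// hi.
exists i; first exact: leqW.
move=> j; rewrite leq_eqVlt => /orP[/eqP /hm h|jN]; last exact: hi.
by rewrite (le_trans h)// ltW.
Qed.

(** * One-step polynomial inequalities for even powers *)

Section EvenMoments.
Variable R : realType.
Implicit Types y d B : R.

Lemma second_moment_step y d B : d ^+ 2 <= B ->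
  (y + d) ^+ 2 <= y ^+ 2 + 2 * y * d + B.
Proof. by move=> dB; rewrite sqrrD; nra. Qed.

(** The odd term [4 y d ^ 3] is at most [2 d ^ 2 (y ^ 2 + d ^ 2)], hence [8 = 6 + 2] and
    [3 = 1 + 2]. The term linear in [d] is kept exact, because the drift will cancel it. *)
Lemma fourth_moment_step y d B : d ^+ 2 <= B ->
  ((y + d) ^+ 2) ^+ 2 <= (y ^+ 2) ^+ 2 + 4 * y ^+ 3 * d + 8 * B * y ^+ 2 + 3 * B ^+ 2.
Proof.
move=> dB; have d0 := sqr_ge0 d; have B0 := le_trans d0 dB.
have h1 : 0 <= (B - d ^+ 2) * y ^+ 2 by rewrite mulr_ge0 ?subr_ge0 ?sqr_ge0.
have h2 : d ^+ 2 ^+ 2 <= B ^+ 2 by apply: lerXn2r; rewrite ?nnegrE.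
have h3 : 0 <= d ^+ 2 * (y - d) ^+ 2 by rewrite mulr_ge0 ?sqr_ge0.
rewrite -subr_ge0.
have -> : (y ^+ 2) ^+ 2 + 4 * y ^+ 3 * d + 8 * B * y ^+ 2 + 3 * B ^+ 2
    - ((y + d) ^+ 2) ^+ 2 = 8 * ((B - d ^+ 2) * y ^+ 2) +
    3 * (B ^+ 2 - d ^+ 2 ^+ 2) + 2 * (d ^+ 2 * (y - d) ^+ 2) by ring.
lra.
Qed.

(** The odd terms are split as [20 y ^ 3 d ^ 3 <= 10 d ^ 2 (y ^ 4 + y ^ 2 d ^ 2)] and
    [6 y d ^ 5 <= 3 d ^ 4 (y ^ 2 + d ^ 2)], and the resulting [28 y ^ 2 d ^ 4] by
    [14 d ^ 2 (y ^ 4 + d ^ 4)]. Hence [39 = 15 + 10 + 14] and [18 = 1 + 3 + 14]; the squares in [h3]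
    are the three remainders. *)
Lemma sixth_moment_step y d B : d ^+ 2 <= B ->
  ((y + d) ^+ 2) ^+ 3 <=
  (y ^+ 2) ^+ 3 + 6 * y ^+ 5 * d + 39 * B * (y ^+ 2) ^+ 2 + 18 * B ^+ 3.
Proof.
move=> dB; have d0 := sqr_ge0 d; have B0 := le_trans d0 dB.
have h1 : 0 <= (B - d ^+ 2) * (y ^+ 2) ^+ 2 by rewrite mulr_ge0 ?subr_ge0 ?sqr_ge0.
have h2 : d ^+ 2 ^+ 3 <= B ^+ 3 by apply: lerXn2r; rewrite ?nnegrE.
have h3 : 0 <= d ^+ 2 * (14 * (y ^+ 2 - d ^+ 2) ^+ 2 + 10 * (y * (y - d)) ^+ 2
    + 3 * (d * (y - d)) ^+ 2).
  apply: mulr_ge0 => //; apply: addr_ge0; first apply: addr_ge0.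
  - by apply: mulr_ge0 => //; exact: sqr_ge0.
  - by apply: mulr_ge0 => //; exact: sqr_ge0.
  - by apply: mulr_ge0 => //; exact: sqr_ge0.
rewrite -subr_ge0.
have -> : (y ^+ 2) ^+ 3 + 6 * y ^+ 5 * d + 39 * B * (y ^+ 2) ^+ 2 + 18 * B ^+ 3
    - ((y + d) ^+ 2) ^+ 3 = 39 * ((B - d ^+ 2) * (y ^+ 2) ^+ 2) +
    18 * (B ^+ 3 - d ^+ 2 ^+ 3) + d ^+ 2 * (14 * (y ^+ 2 - d ^+ 2) ^+ 2
    + 10 * (y * (y - d)) ^+ 2 + 3 * (d * (y - d)) ^+ 2) by ring.
lra.
Qed.

End EvenMoments.

Section Quenched.
Variables (R : realType) (M : R) (w : int -> R).
Hypothesis w_itv : forall i, 0 <= w i <= M.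
Variable kappa : R.
Hypotheses (kappa_gt0 : 0 < kappa) (kappa_lt1 : kappa < 1).
Variable C : R.
Hypothesis growth : forall L i,
  green_sum M w L i ^+ 12 <= C * (1 + `|i|%N%:R) ^+ 2.

Let lam := lambda M.
Let lam_gt0 : 0 < lam := lambda_gt0 w_itv.
Let p := trans M w kappa.
Let ps := psi M w kappa.
Let ps_gt0 i : 0 < ps i := psi_gt0 w_itv kappa_gt0 kappa_lt1 i.
Let p_ge0 i j : 0 <= p i j := trans_ge0 w_itv kappa_gt0 kappa_lt1 i j.

Lemma trans_near i j : (1 < `|i - j|)%N -> p i j = 0.
Proof.
move=> ij; rewrite /p /trans; case: eqP => [ji|_]; first by lia.
by case: eqP => [ji|_]; [lia|case: eqP => [ji|//]; lia].
Qed.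

Lemma chain_step_trans (g : int -> R) i :
  chain_step p (fun j => g j / ps j) i =
  (g (i + 1) + w i * g i + g (i - 1)) / (lam * ps i).
Proof.
rewrite /chain_step /p trans_left trans_right trans_stay -/ps -/lam.
by field; rewrite !gt_eqF.
Qed.

Context d (T : measurableType d) (Q : probability T R).
Variables (k : int) (X : nat -> T -> int).
Hypothesis chainX : markov_chain Q p k X.

(* [phi] is the Green function of [A] at [lambda] with pole [i0]: an
   eigenvector on either side of [i0], with a defect at [i0]. *)
Lemma ae_leaves i0 : \forall t \ae Q, \forall n \near \oo, X n t != i0.
Proof.
have pp0 := psi_plus_gt0 w_itv; have pm0 := psi_minus_gt0 w_itv.
pose phi (j : int) := if j <= i0 then psi_plus M w j / psi_plus M w i0
                      else psi_minus M w j / psi_minus M w i0.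
(* The defect of [phi] at [i0], divided by [lam * ps i0]. It is positive because
   [alpha <= 1 < 1 / beta]; the strict inequality is where the finiteness of the Green function
   enters. *)
pose c := ((beta M w i0)^-1 - alpha M w (i0 + 1)) / (lam * ps i0).
have b0 := beta_gt0 w_itv i0; have b1 := beta_lt1 w_itv growth i0.
have c0 : 0 < c.
  rewrite divr_gt0 ?mulr_gt0// subr_gt0.
  have /andP[_ a1] := alpha_itv w_itv (i0 + 1).
  by apply: le_lt_trans a1 _; rewrite invf_gt1.
apply: (@ae_leaves_site _ _ _ Q p k X chainX p_ge0 trans_near
  (fun j => phi j / ps j) c) => //.
  by move=> j; rewrite divr_ge0 ?(ltW (ps_gt0 j))// /phi; case: ifP => _; rewrite divr_ge0 // ltW.
move=> j; rewrite chain_step_trans.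
have psp := psi_plus_eigen w_itv j; have psm := psi_minus_eigen w_itv j.
have [ji|ji|ji] := ltgtP j i0.
- have -> : phi (j + 1) = psi_plus M w (j + 1) / psi_plus M w i0.
    by rewrite /phi; have -> : (j + 1 <= i0) by lia.
  have phij : phi j = psi_plus M w j / psi_plus M w i0 by rewrite /phi ltW.
  have -> : phi (j - 1) = psi_plus M w (j - 1) / psi_plus M w i0.
    by rewrite /phi; have -> : (j - 1 <= i0) by lia.
  rewrite mulr0 addr0 phij.
  have -> : psi_plus M w (j + 1) / psi_plus M w i0 +
     w j * (psi_plus M w j / psi_plus M w i0) + psi_plus M w (j - 1) / psi_plus M w i0
     = lam * (psi_plus M w j / psi_plus M w i0) by rewrite !mulrA -psp; ring.
  by rewrite -mulf_div divff ?mul1r// gt_eqF.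
- have -> : phi (j + 1) = psi_minus M w (j + 1) / psi_minus M w i0.
    by rewrite /phi; have -> : (j + 1 <= i0) = false by lia.
  have phij : phi j = psi_minus M w j / psi_minus M w i0.
    by rewrite /phi; have -> : (j <= i0) = false by lia.
  have -> : phi (j - 1) = psi_minus M w (j - 1) / psi_minus M w i0.
    (* For [j = i0 + 1] the left neighbour lies in the other branch of [phi], but both branches
       equal [1] at [i0]. *)
    rewrite /phi; case: ifP => // ji'; have -> : j - 1 = i0 by lia.
    by rewrite !divff// gt_eqF.
  rewrite mulr0 addr0 phij.
  have -> : psi_minus M w (j + 1) / psi_minus M w i0 +
     w j * (psi_minus M w j / psi_minus M w i0) + psi_minus M w (j - 1) / psi_minus M w i0
     = lam * (psi_minus M w j / psi_minus M w i0) by rewrite !mulrA -psm; ring.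
  by rewrite -mulf_div divff ?mul1r// gt_eqF.
- rewrite {}ji in psp psm *.
  have -> : phi (i0 + 1) = alpha M w (i0 + 1).
    rewrite /phi; have -> : (i0 + 1 <= i0) = false by lia.
    by rewrite psi_minusS// mulfK// gt_eqF.
  have -> : phi i0 = 1 by rewrite /phi lexx divff// gt_eqF.
  have -> : phi (i0 - 1) = lam - w i0 - (beta M w i0)^-1.
    rewrite /phi; have -> : (i0 - 1 <= i0) by lia.
    have := psi_plusS w_itv i0 => e; rewrite e in psp.
    have -> : psi_plus M w (i0 - 1) = lam * psi_plus M w i0 -
      psi_plus M w i0 / beta M w i0 - w i0 * psi_plus M w i0 by rewrite -psp; ring.
    by field; rewrite !gt_eqF.
  rewrite !mulr1 /c le_eqVlt; apply/orP; left; apply/eqP.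
  by field; rewrite !gt_eqF.
Qed.

Lemma ae_escapes : \forall t \ae Q, to_pinfty R X t \/ to_ninfty R X t.
Proof. exact: (ae_escape chainX p_ge0 trans_near ae_leaves). Qed.

Lemma escape_total : (Q (to_pinfty R X) + Q (to_ninfty R X) = 1)%E.
Proof. exact: (escape_probability chainX ae_escapes). Qed.

Let S i := site_time M w i.
Let S_gt0 i : 0 < S i := site_time_gt0 w_itv growth i.

Definition clock (i : int) : R :=
  match i with
  | Posz n => \sum_(j < n) S j%:Z
  | Negz n => - \sum_(j < n.+1) S (- j.+1%:Z)
  end.

Lemma clockS i : clock (i + 1) = clock i + S i.
Proof.
case: i => n.
  have -> : n%:Z + 1 = n.+1%:Z by lia.
  by rewrite /clock big_ord_recr.
case: n => [|n].
  have -> : Negz 0 + 1 = 0%N%:Z by lia.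
  by rewrite /clock big_ord0 big_ord1 NegzE addNr.
have -> : Negz n.+1 + 1 = Negz n by lia.
by rewrite /clock [in RHS]big_ord_recr/= NegzE opprD addrNK.
Qed.

Let f i := clock i - clock k.
Let h i := kappa * psi_plus M w i / ps i.

Let h_ge0 i : 0 <= h i.
Proof. by rewrite divr_ge0 ?mulr_ge0 ?(ltW kappa_gt0) ?ltW ?psi_plus_gt0. Qed.

Let h_le1 i : h i <= 1.
Proof.
rewrite ler_pdivrMr// mul1r /ps /psi lerDl mulr_ge0 ?subr_ge0 ?(ltW kappa_lt1)//.
exact/ltW/psi_minus_gt0.
Qed.

(** On the right half-line [psi_minus <= 1 <= psi_plus], so the convex combination [psi] is at most
    [psi_plus]. *)
Let h_ge_kappa (n : nat) : kappa <= h n%:Z.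
Proof.
rewrite ler_pdivlMr// ler_pM2l// /ps /psi.
have p1 := psi_plus_ge1 w_itv n; have m1 := psi_minus_le1 w_itv n.
have k1 : 0 <= 1 - kappa by rewrite subr_ge0 ltW.
have : (1 - kappa) * psi_minus M w n <= (1 - kappa) * psi_plus M w n.
  by rewrite ler_wpM2l// (le_trans m1).
by lra.
Qed.

(* The [h]-transform by [kappa psi^+ / psi] turns the chain into the one with
   [kappa = 1]. *)
Lemma chain_step_h (g : int -> R) i :
  chain_step p (fun j => h j * g j) i = h i *
  (((beta M w i)^-1 * g (i + 1) + w i * g i + beta M w (i - 1) * g (i - 1)) / lam).
Proof.
have -> : (fun j => h j * g j) = (fun j => kappa * psi_plus M w j * g j / ps j).
  by apply/funext => j; rewrite /h mulrAC.
rewrite chain_step_trans psi_plusS//.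
have := psi_plusS w_itv (i - 1); rewrite subrK => e.
have -> : psi_plus M w (i - 1) = psi_plus M w i * beta M w (i - 1).
  by rewrite e mulfVK// gt_eqF// beta_gt0.
by rewrite /h; field; rewrite !gt_eqF// beta_gt0.
Qed.

Let mX n i : measurable (X n @^-1` [set i]).
Proof. by have [] := chainX. Qed.

Let mGX m (H : int -> R) : measurable_fun setT (fun t => H (X m t)).
Proof. exact: (measurable_fun_int (mX m)). Qed.

(** The moment of order [2 q] of the martingale under the h-transform, up to the factor [h k],
    written as an integral against the given law. The power of a square makes nonnegativity
    immediate. *)
Let mom q n : \bar R := (\int[Q]_t (h (X n t) * ((f (X n t) - n%:R) ^+ 2) ^+ q)%:E)%E.

Let mom_term_ge0 q (n : nat) i : 0 <= h i * ((f i - n%:R) ^+ 2) ^+ q.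
Proof. by rewrite mulr_ge0// exprn_ge0// sqr_ge0. Qed.

Let mom_start q : mom q.+1 0 = 0%E.
Proof.
rewrite /mom (integral_start chainX (fun i => mom_term_ge0 q.+1 0 i)).
by rewrite /f subrr subr0 expr0n/= expr0n/= mulr0.
Qed.

Let mom0_le n : (mom 0 n <= 1)%E.
Proof.
rewrite /mom -(integral_prob_cst Q 1); apply: integral_EFin_le => //.
  exact: (mGX n (fun i => h i * ((f i - n%:R) ^+ 2) ^+ 0)).
by move=> t; rewrite mom_term_ge0/= expr0 mulr1.
Qed.

(** Any expansion of a power whose first-order part is [L y * d] yields a moment recursion: the
    weights of the transformed chain have total mass one and give [d] mean zero, so that part drops
    out whatever [L] is. The constant term is multiplied by the mean of [h], at most [1]. *)
Let mom_step (B a b : R) (L : R -> R) q q' n :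
  0 <= a -> 0 <= b ->
  (forall i, (`|i| <= `|k| + n)%N -> jump_bound M w i ^+ 2 <= B) ->
  (forall y d, d ^+ 2 <= B -> ((y + d) ^+ 2) ^+ q <=
     (y ^+ 2) ^+ q + L y * d + a * (y ^+ 2) ^+ q' + b) ->
  (mom q n.+1 <= mom q n + a%:E * mom q' n + b%:E)%E.
Proof.
move=> a0 b0 hB hL.
pose H i := h i * ((f i - n%:R) ^+ 2) ^+ q + a * (h i * ((f i - n%:R) ^+ 2) ^+ q')
  + b * (h i * ((f i - n%:R) ^+ 2) ^+ 0).
have H0 i : 0 <= H i.
  by rewrite !addr_ge0// mulr_ge0// mom_term_ge0.
apply: (@le_trans _ _ (\int[Q]_t (H (X n t))%:E)%E).
  apply: (integral_chain_step_le chainX p_ge0 trans_near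
    (G := fun i => h i * ((f i - n.+1%:R) ^+ 2) ^+ q)) => // i hi.
  rewrite chain_step_h.
  have -> : H i = h i * (((f i - n%:R) ^+ 2) ^+ q + a * ((f i - n%:R) ^+ 2) ^+ q' + b).
    by rewrite /H expr0; ring.
  rewrite ler_wpM2l//; set y := f i - n%:R.
  have fi1 : f (i + 1) - n.+1%:R = y + (S i - 1).
    by rewrite /y /f clockS -natr1; ring.
  have fi0 : f i - n.+1%:R = y + (- 1) by rewrite /y -natr1; ring.
  have fim : f (i - 1) - n.+1%:R = y + (- S (i - 1) - 1).
    have := clockS (i - 1); rewrite subrK /y /f => ->.
    by rewrite -natr1; ring.
  rewrite fi1 fi0 fim.
  have jB := hB i hi.
  have s0 := ltW (S_gt0 i); have s1 := ltW (S_gt0 (i - 1)).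
  have jb : jump_bound M w i = 1 + S i + S (i - 1) by [].
  rewrite jb in jB.
  have d1 : (S i - 1) ^+ 2 <= B.
    by apply: le_trans jB; set u := S i in s0 *; set v := S (i - 1) in s1 *; nra.
  have d2 : (- 1) ^+ 2 <= B.
    by apply: le_trans jB; set u := S i in s0 *; set v := S (i - 1) in s1 *; nra.
  have d3 : (- S (i - 1) - 1) ^+ 2 <= B.
    by apply: le_trans jB; set u := S i in s0 *; set v := S (i - 1) in s1 *; nra.
  have e1 := hL y _ d1; have e2 := hL y _ d2; have e3 := hL y _ d3.
  have r0 : 0 <= (beta M w i)^-1 by rewrite invr_ge0 beta_ge0.
  have w0 : 0 <= w i by have /andP[] := w_itv i.
  have l0 : 0 <= beta M w (i - 1) by rewrite beta_ge0.
  have f1 := ler_wpM2l r0 e1; have f2 := ler_wpM2l w0 e2; have f3 := ler_wpM2l l0 e3.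
  rewrite ler_pdivrMr//; apply: le_trans (lerD (lerD f1 f2) f3) _.
  have dr := site_time_drift w_itv growth i; rewrite -/(S i) -/(S (i - 1)) in dr.
  have lE : lam = (beta M w i)^-1 + w i + beta M w (i - 1).
    by rewrite (beta_inv w_itv) /lam; ring.
  set Y := (y ^+ 2) ^+ q; set Y' := (y ^+ 2) ^+ q'.
  rewrite le_eqVlt; apply/orP; left; apply/eqP.
  (* The bracket multiplying [L y] is [lam] times the drift of [f (X n) - n], which
     [site_time_drift] makes zero. *)
  transitivity (((beta M w i)^-1 + w i + beta M w (i - 1)) * (Y + a * Y' + b) +
    L y * ((beta M w i)^-1 * S i - beta M w (i - 1) * S (i - 1) -
     ((beta M w i)^-1 + w i + beta M w (i - 1)))); first by ring.
  by rewrite dr -lE /lam subrr mulr0 addr0 mulrC.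
have mm q'' : measurable_fun setT
    (fun t => h (X n t) * ((f (X n t) - n%:R) ^+ 2) ^+ q'').
  exact: (mGX n (fun i => h i * ((f i - n%:R) ^+ 2) ^+ q'')).
have ma c q'' : measurable_fun setT
    (fun t => c * (h (X n t) * ((f (X n t) - n%:R) ^+ 2) ^+ q'')).
  exact: (mGX n (fun i => c * (h i * ((f i - n%:R) ^+ 2) ^+ q''))).
have t0 q'' t : 0 <= h (X n t) * ((f (X n t) - n%:R) ^+ 2) ^+ q'' by exact: mom_term_ge0.
rewrite /H integral_EFinD; last 4 first.
- exact: measurable_funD.
- exact: ma.
- by move=> t; rewrite addr_ge0// mulr_ge0.
- by move=> t; rewrite mulr_ge0.
rewrite integral_EFinD//; last by move=> t; rewrite mulr_ge0.
rewrite (integral_EFinZ Q (mm q') (t0 q') a0) (integral_EFinZ Q (mm 0%N) (t0 0%N) b0).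
apply: leeD2l; rewrite -[leRHS]mule1; apply: lee_wpmul2l; first by rewrite lee_fin.
exact: mom0_le.
Qed.

(** The constants solve the recursions: [11 = 8 + 3], and [143 = 39 * 11 / 3] makes the leading
    terms of the cubic increment cancel. *)
Let mom_bounds N B : (forall i, (`|i| <= `|k| + N)%N -> jump_bound M w i ^+ 2 <= B) ->
  forall n, (n <= N)%N -> [/\ (mom 1 n <= (n%:R * B)%:E)%E,
    (mom 2 n <= (11 * n%:R ^+ 2 * B ^+ 2)%:E)%E &
    (mom 3 n <= (143 * n%:R ^+ 3 * B ^+ 3)%:E)%E].
Proof.
move=> hB.
have B0 : 0 <= B by apply: le_trans (sqr_ge0 _) (hB 0 _); lia.
elim=> [|n IHn] nN.
  by rewrite !mom_start !expr0n/= !mulr0 !mul0r lexx.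
have [h1 h2 h3] := IHn (ltnW nN).
have hBn i : (`|i| <= `|k| + n)%N -> jump_bound M w i ^+ 2 <= B.
  by move=> hi; apply: hB; lia.
have n0 : 0 <= n%:R :> R by [].
have B2 : 0 <= B ^+ 2 by exact: sqr_ge0.
have B3 : 0 <= B ^+ 3 by rewrite exprn_ge0.
split.
- apply: le_trans (@mom_step B 0 B (fun y => 2 * y) 1 0 n _ _ hBn _) _ => //.
    by move=> y e eB; rewrite !expr1 mul0r addr0; exact: second_moment_step.
  rewrite mul0e adde0 -natr1 mulrDl mul1r EFinD; exact: leeD2r.
- apply: le_trans (@mom_step B (8 * B) (3 * B ^+ 2) (fun y => 4 * y ^+ 3) 2 1 n _ _ hBn _) _.
  + by rewrite mulr_ge0.
  + by rewrite mulr_ge0.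
  + by move=> y e eB; rewrite !expr1; exact: fourth_moment_step.
  apply: (@le_trans _ _ ((11 * n%:R ^+ 2 * B ^+ 2)%:E + (8 * B)%:E * (n%:R * B)%:E
     + (3 * B ^+ 2)%:E)%E).
    apply: leeD => //; apply: leeD => //; apply: lee_wpmul2l => //.
    by rewrite lee_fin mulr_ge0.
  rewrite -EFinM -!EFinD lee_fin -(natr1 n) -subr_ge0.
  set u : R := n%:R in n0 *.
  have -> : 11 * (u + 1) ^+ 2 * B ^+ 2 - (11 * u ^+ 2 * B ^+ 2 + 8 * B * (u * B)
    + 3 * B ^+ 2) = (14 * u + 8) * B ^+ 2 by ring.
  by rewrite mulr_ge0// addr_ge0 ?mulr_ge0.
- apply: le_trans (@mom_step B (39 * B) (18 * B ^+ 3) (fun y => 6 * y ^+ 5) 3 2 n _ _ hBn _) _.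
  + by rewrite mulr_ge0.
  + by rewrite mulr_ge0.
  + by move=> y e eB; exact: sixth_moment_step.
  apply: (@le_trans _ _ ((143 * n%:R ^+ 3 * B ^+ 3)%:E + (39 * B)%:E *
     (11 * n%:R ^+ 2 * B ^+ 2)%:E + (18 * B ^+ 3)%:E)%E).
    apply: leeD => //; apply: leeD => //; apply: lee_wpmul2l => //.
    by rewrite lee_fin mulr_ge0.
  rewrite -EFinM -!EFinD lee_fin -(natr1 n) -subr_ge0.
  set u : R := n%:R in n0 *.
  have -> : 143 * (u + 1) ^+ 3 * B ^+ 3 - (143 * u ^+ 3 * B ^+ 3 + 39 * B *
    (11 * u ^+ 2 * B ^+ 2) + 18 * B ^+ 3) = (429 * u + 125) * B ^+ 3 by ring.
  by rewrite mulr_ge0// addr_ge0 ?mulr_ge0.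
Qed.

Let mom3_le : exists2 D, 0 <= D &
  forall n, (mom 3 n.+1 <= (D * n.+1%:R ^+ 4)%:E)%E.
Proof.
have [D D0 hD] := jump_bound_growth w_itv growth.
exists (143 * (D * (3 + `|k|%N%:R))).
  by rewrite !mulr_ge0// addr_ge0.
move=> n.
have [i iN hi] := finite_max_int (fun i => jump_bound M w i ^+ 2) (`|k| + n.+1).
have [_ _ h3] := mom_bounds hi (leqnn n.+1).
apply: (le_trans h3); rewrite lee_fin -exprM.
set u : R := n.+1%:R.
have u1 : 1 <= u by rewrite ler1n.
have u0 := le_trans ler01 u1.
have hj : jump_bound M w i ^+ 6 <= D * ((3 + `|k|%N%:R) * u).
  apply: (le_trans (hD i)); rewrite ler_wpM2l//.
  have : `|i|%N%:R <= `|k|%N%:R + u by rewrite -natrD ler_nat.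
  by have : 0 <= `|k|%N%:R :> R by []; set a : R := `|k|%N%:R; nra.
have -> : 143 * (D * (3 + `|k|%N%:R)) * u ^+ 4 =
  143 * u ^+ 3 * (D * ((3 + `|k|%N%:R) * u)) by ring.
by rewrite ler_wpM2l// mulr_ge0// exprn_ge0.
Qed.

(** The weighted sixth moments have mean at most [D / n ^ 2], so the weighted terms tend to zero
    almost surely. On the event the chain is eventually on the right half-line, where [h >= kappa]
    removes the weight. *)
Lemma ae_clock : \forall t \ae Q, to_pinfty R X t ->
  clock (X n t) / n%:R @[n --> \oo] --> (1 : R).
Proof.
have [D D0 hD] := mom3_le.
pose e n t := h (X n.+1 t) * ((f (X n.+1 t) - n.+1%:R) ^+ 2) ^+ 3.
pose g n t := \sum_(m < n) (m.+1%:R ^+ 6)^-1 * e m t.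
have e0 n t : 0 <= e n t by exact: mom_term_ge0.
have me n : measurable_fun setT (e n).
  exact: (mGX n.+1 (fun i => h i * ((f i - n.+1%:R) ^+ 2) ^+ 3)).
have t0 n t : 0 <= (n.+1%:R ^+ 6)^-1 * e n t by rewrite mulr_ge0// invr_ge0 exprn_ge0.
have mt n : measurable_fun setT (fun t => (n.+1%:R ^+ 6)^-1 * e n t).
  exact: measurable_funM.
have mg n : measurable_fun setT (g n) by apply: measurable_sum => m; exact: mt.
have g0 n t : 0 <= g n t by exact: sumr_ge0.
have nd_g t : nondecreasing_seq (g ^~ t).
  by apply/nondecreasing_seqP => n; rewrite /g big_ord_recr lerDl.
have gC n : (\int[Q]_t (g n t)%:E <= (D * 2)%:E)%E.
  rewrite integral_EFin_sum//.
  apply: (@le_trans _ _ (\sum_(m < n) (D * (m.+1%:R ^+ 2)^-1)%:E)%E); last first.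
    by rewrite sumEFin lee_fin -mulr_sumr ler_wpM2l// sum_inv_sqr_le.
  apply: lee_sum => m _.
  have c0 : 0 <= (m.+1%:R ^+ 6)^-1 :> R by rewrite invr_ge0 exprn_ge0.
  rewrite (integral_EFinZ Q (me m) (e0 m) c0).
  apply: (@le_trans _ _ (((m.+1%:R ^+ 6)^-1)%:E * (D * m.+1%:R ^+ 4)%:E)%E).
    by apply: lee_wpmul2l; [rewrite lee_fin|exact: hD].
  rewrite -EFinM lee_fin le_eqVlt; apply/orP; left; apply/eqP.
  have : m.+1%:R != 0 :> R by rewrite pnatr_eq0.
  by set u : R := m.+1%:R => u0; field.
have := ae_bounded_nd mg g0 nd_g gC; apply: filterS => t [B hB] /int_cvg_pinftyP Xoo.
have ecvg : (n.+1%:R ^+ 6)^-1 * e n t @[n --> \oo] --> (0 : R).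
  by apply: (@cvg0_of_bounded_sum _ _ B) => // n; exact: t0.
have fcvg : (f (X n.+1 t) - n.+1%:R) / n.+1%:R @[n --> \oo] --> (0 : R).
  apply/cvgr0Pnorm_lt => eps eps0.
  have ke : 0 < kappa * eps ^+ 6 by rewrite mulr_gt0// exprn_gt0.
  have h1 : \forall n \near \oo, (n.+1%:R ^+ 6)^-1 * e n t < kappa * eps ^+ 6.
    exact: (cvgr_lt 0 ecvg).
  have h2 : \forall n \near \oo, 0 <= X n.+1 t.
    by have [N _ hN] := Xoo 0%N; exists N => // n /= Nn; apply: hN => /=; exact: leqW.
  move: h1 h2; apply: filterS2 => n h1 h2.
  set z := (f (X n.+1 t) - n.+1%:R) / n.+1%:R.
  have kh : kappa <= h (X n.+1 t) by case: (X n.+1 t) h2 => // m _; exact: h_ge_kappa.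
  have zE : (n.+1%:R ^+ 6)^-1 * e n t = h (X n.+1 t) * z ^+ 6.
    have : n.+1%:R != 0 :> R by rewrite pnatr_eq0.
    by rewrite /e /z; set u : R := n.+1%:R => u0; field.
  have z6 : 0 <= z ^+ 6 by rewrite (exprM z 2 3) exprn_ge0// sqr_ge0.
  have : kappa * z ^+ 6 < kappa * eps ^+ 6.
    by apply: le_lt_trans h1; rewrite zE ler_wpM2r.
  rewrite ltr_pM2l// => zeps.
  rewrite -(@ltr_pXn2r _ 6)// ?nnegrE ?(ltW eps0)//.
  by rewrite -normrX ger0_norm.
have inv_cvg : (clock k) * (n.+1%:R)^-1 @[n --> \oo] --> (0 : R).
  rewrite -[X in _ --> X](mulr0 (clock k)); apply: cvgM; first exact: cvg_cst.
  exact: cvg_harmonic.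
have sum_cvg := cvgD (cvgD fcvg (cvg_cst (1 : R))) inv_cvg.
rewrite add0r addr0 in sum_cvg.
suff shifted : clock (X n.+1 t) / n.+1%:R @[n --> \oo] --> (1 : R).
  by rewrite -(cvg_shiftS _); exact: shifted.
have -> : (fun n => clock (X n.+1 t) / n.+1%:R) =
  (fun n => (f (X n.+1 t) - n.+1%:R) / n.+1%:R + 1 + clock k * n.+1%:R^-1);
  last exact: sum_cvg.
apply/funext => n; have : n.+1%:R != 0 :> R by rewrite pnatr_eq0.
by rewrite /f /=; set u : R := n.+1%:R => u0; field.
Qed.

(** Along a path going to [+oo], the law of large numbers is read at the index [|X n|], and
    [clock (X n) / n] is divided by [clock (X n) / X n]. *)
Lemma ae_speed (s : R) : 0 < s ->
  (\sum_(j < n) S j%:Z) / n%:R @[n --> \oo] --> s ->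
  \forall t \ae Q, to_pinfty R X t -> (X n t)%:~R / n%:R @[n --> \oo] --> s^-1.
Proof.
move=> s0 Scvg; have := ae_clock; apply: filterS => t hc Xp; have cc := hc Xp.
move/int_cvg_pinftyP in Xp.
have absoo : `|X n t|%N @[n --> \oo] --> \oo.
  move=> A [N _ NA]; have := Xp N; apply: filterS => n hn /=; apply: NA => /=; lia.
have rc := cvg_comp _ _ absoo Scvg.
have rcV : ((\sum_(j < `|X n t|%N) S j%:Z) / `|X n t|%N%:R)^-1 @[n --> \oo] --> s^-1.
  by apply: cvgV; [rewrite gt_eqF|exact: rc].
have prod_cvg : clock (X n t) / n%:R *
    ((\sum_(j < `|X n t|%N) S j%:Z) / `|X n t|%N%:R)^-1 @[n --> \oo] --> s^-1.
  by rewrite -[X in _ --> X]mul1r; exact: (cvgM cc rcV).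
have key : {near \oo, (fun n => clock (X n t) / n%:R *
    ((\sum_(j < `|X n t|%N) S j%:Z) / `|X n t|%N%:R)^-1) =1
    (fun n => (X n t)%:~R / n%:R)}; last exact: (cvg_trans (near_eq_cvg key) prod_cvg).
have := Xp 1%N; apply: filterS => n; case: (X n t) => // m m1 /=.
have m0 : (0 < m)%N by lia.
have mS : 0 < \sum_(j < m) S j%:Z.
  case: m m0 {m1} => // m _; rewrite big_ord_recr/=.
  by apply: ltr_wpDl => //; apply: sumr_ge0 => j _; exact: ltW.
(* At [n = 0] both sides vanish, the inverse of [0] being [0]. *)
have [->|n0] := eqVneq n 0%N; first by rewrite invr0 !mulr0 mul0r.
rewrite -[(m%:Z)%:~R]/(m%:R : R).
have {}n0 : n%:R != 0 :> R by rewrite pnatr_eq0.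
have {}m0 : m%:R != 0 :> R by rewrite pnatr_eq0 -lt0n.
set u := \sum_(j < m) _ in mS *.
by field; rewrite n0 m0 gt_eqF.
Qed.

End Quenched.

(** * Almost every environment *)

Section IntegralOffNullSet.
Context d (T : measurableType d) (R : realType) (mu : {measure set T -> \bar R}).
Variable N : set T.
Hypotheses (mN : measurable N) (muN : mu N = 0%E).

Import HBNNSimple.

(** The integral is a supremum over simple functions below the integrand. A simple function below
    [f], cut to zero on [N], lies below [g] and has the same integral. *)
Let ge0_integral_off_null_le (f g : T -> \bar R) :
  (forall x, 0 <= f x)%E -> (forall x, 0 <= g x)%E ->
  (forall x, ~ N x -> f x = g x) -> (\int[mu]_x f x <= \int[mu]_x g x)%E.
Proof.
move=> f0 g0 fg; rewrite [leLHS]ge0_integralTE// [leRHS]ge0_integralTE//.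
apply: ge_ereal_sup => _ [h hf <-].
pose h' := mul_nnsfun h (indic_nnsfun R (measurableC mN)).
have h'E x : h' x = h x * \1_(~` N) x by [].
apply: ereal_sup_ubound; exists h'.
  move=> x /=; rewrite -[h x * _]/(h' x) h'E indicE.
  have [Nx|Nx] := pselect (N x).
    by rewrite memNset ?mulr0//=; exact.
  by rewrite mem_set// mulr1 -fg//; exact: hf.
rewrite -!integralT_nnsfun; apply: ge0_ae_eq_integral => //.
- by apply/measurable_EFinP.
- by apply/measurable_EFinP.
- by move=> x _; rewrite lee_fin.
- by move=> x _; rewrite lee_fin.
exists N; split=> // x /= /not_implyP[_ hx]; apply: contrapT => Nx; apply: hx.
by rewrite -[h x * _]/(h' x) h'E indicE mem_set ?mulr1.
Qed.

(* Stated without measurability: [speed_sum] takes junk values outside the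
   almost sure event that all [w i] lie in [0, M]. *)
Lemma integral_off_null (f g : T -> \bar R) :
  (forall x, ~ N x -> f x = g x) -> (\int[mu]_x f x = \int[mu]_x g x)%E.
Proof.
move=> fg; rewrite integralE [RHS]integralE.
by congr (_ - _)%E; apply/eqP; rewrite eq_le; apply/andP; split;
  apply: ge0_integral_off_null_le => // x Nx; rewrite ?funeposE ?funenegE fg.
Qed.

End IntegralOffNullSet.

Lemma speed_sum_crossing_mean (R : realType) (M : R) (x : env R) : 0 < M ->
  (forall i, 0 <= x i <= M) -> speed_sum M x = crossing_mean M 0 x.
Proof.
move=> M0 x_itv.
have l0 : 0 <= lambda M := ltW (lambda_gt0 x_itv).
have b0 i : 0 <= beta M x i := beta_ge0 x_itv i.
pose a i := \prod_(1 <= j < i.+1) beta M x (- j%:Z) ^+ 2.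
have a0 i : 0 <= a i by apply: prodr_ge0 => j _; exact: sqr_ge0.
rewrite /speed_sum -nneseriesZl; last by move=> i *; rewrite lee_fin mulr_ge0 ?a0.
pose c i := (lambda M * (beta M x 0 * a i))%:E.
have c0 i : (0 <= c i)%E by rewrite lee_fin !mulr_ge0.
transitivity (\sum_(0 <= i <oo) c i)%E.
  rewrite [RHS]nneseries_recl// /c /a big_geq// mulr1; congr (_ + _)%E.
rewrite /crossing_mean.
suff -> : (fun n => \sum_(0 <= i < n) c i)%E = (fun L => (crossing_sum M L 0 x)%:E) by [].
apply/funext => L; rewrite /c sumEFin /crossing_sum clip_id// green_sumE.
rewrite -!mulr_sumr big_mkord; congr ((_ * (_ * _))%:E).
by apply: eq_bigr => i _; apply: eq_bigr => j _; rewrite sub0r.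
Qed.

Section IidEnvironment.
Variables (R : realType) (M : R) (nu : probability R R).
Context d (Omega : measurableType d) (mu : probability Omega R).
Variable W : Omega -> env R.
Hypotheses (M_gt0 : 0 < M) (nu_supp : nu `[0, M]%classic = 1%E).
Hypothesis nu_dirac : ~ (forall A : set R, measurable A -> nu A = \d_M A).
Hypothesis iidW : iid_env nu mu W.

Let mW : measurable_fun setT W. Proof. by have [] := iidW. Qed.

Let WX : {mfun Omega >-> env R} := HB.pack W (isMeasurableFun.Build _ _ _ _ _ mW).

Let P : probability (env R) R := distribution mu WX.

Let iidP : iid_env nu P id.
Proof.
split; first exact: measurable_id.
by move=> s A us mA; have [_ h] := iidW; exact: h.
Qed.

Let mu_coord i (A : set R) : measurable A -> mu [set om | A (W om i)] = nu A.
Proof.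
move=> mA; have [_ h] := iidW.
have := h [:: i] (fun=> A) isT (fun=> mA).
rewrite big_seq1 fineK ?fin_num_measure// => <-; congr (mu _).
apply/seteqP; split=> om /=; first by move=> h' j; rewrite inE => /eqP ->.
by apply; rewrite inE.
Qed.

Let nu_out : nu (~` `[0, M]%classic) = 0%E.
Proof. by rewrite [LHS]probability_setC// nu_supp subee. Qed.

Lemma ae_env_itv : \forall om \ae mu, forall i, 0 <= W om i <= M.
Proof.
apply: ae_forall_int => i.
exists [set om | (~` `[0, M]%classic) (W om i)]; split.
- have := @measurableT_comp _ _ _ _ _ _ _ setT _ (measurable_env_coord i) mW.
  by move=> /(_ measurableT _ (measurableC (measurable_itv `[0, M]))); rewrite setTI.
- by rewrite [LHS]mu_coord//; exact: measurableC.
- by move=> om /= h; rewrite in_itv/=.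
Qed.

Let rho := fine (\int[P]_x (drop_factor M (clip M x) 0)%:E).

Let drop0 (x : env R) : 0 <= drop_factor M (clip M x) 0.
Proof. by have /andP[/ltW] := drop_factor_itv (clip_itv M_gt0 x) 0. Qed.

Let drop1 (x : env R) : drop_factor M (clip M x) 0 <= 1.
Proof. by have /andP[] := drop_factor_itv (clip_itv M_gt0 x) 0. Qed.

Let mdrop := @measurable_drop_factor R M M_gt0 0.

Let int_drop_le1 : (\int[P]_x (drop_factor M (clip M x) 0)%:E <= 1)%E.
Proof.
rewrite -(integral_prob_cst P 1); apply: integral_EFin_le => // x.
by rewrite drop0 drop1.
Qed.

Let rho_drop : (\int[P]_x (drop_factor M (clip M x) 0)%:E = rho%:E)%E.
Proof.
rewrite /rho fineK// ge0_fin_numE.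
  by rewrite (le_lt_trans int_drop_le1)// ltry.
by apply: integral_ge0 => x _; rewrite lee_fin.
Qed.

(** If the mean of the drop factor were [1], the factor, being at most [1], would be [1] almost
    surely. The clipped value would then be [M], so [nu] would give no mass to values below [M] and,
    by its support, be the Dirac mass at [M]. *)
Let rho_lt1 : rho < 1.
Proof.
rewrite ltNge; apply/negP => rho1; apply: nu_dirac.
have rhoE : rho = 1.
  by apply/eqP; rewrite eq_le rho1 andbT -lee_fin -rho_drop.
have m1 : measurable_fun setT (fun x => 1 - drop_factor M (clip M x) 0).
  exact: measurable_funB.
have d0 x : 0 <= 1 - drop_factor M (clip M x) 0 by rewrite subr_ge0.
have z : (\int[P]_x (1 - drop_factor M (clip M x) 0)%:E = 0)%E.
  have := integral_EFinD P mdrop m1 drop0 d0.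
  under eq_integral do rewrite addrC subrK.
  rewrite integral_prob_cst rho_drop rhoE.
  case: (\int[P]_x (1 - drop_factor M (clip M x) 0)%:E)%E => // r [h].
  by congr (_%:E); lra.
have nuM : nu `]-oo, M[%classic = 0%E.
  have m1E : measurable_fun setT (fun x => (1 - drop_factor M (clip M x) 0)%:E).
    by apply/measurable_EFinP.
  have [+ _] := ae_eq_integral_abs P measurableT m1E.
  under eq_integral do rewrite gee0_abs ?lee_fin//.
  move=> /(_ z) [N [mN PN hN]].
  rewrite -(mu_coord 0)//.
  apply/eqP; rewrite eq_le measure_ge0 andbT.
  rewrite -[leRHS]PN -[leRHS]/(mu (W @^-1` N)); apply: le_measure; rewrite ?inE.
  - have := @measurableT_comp _ _ _ _ _ _ _ setT _ (measurable_env_coord 0) mW.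
    by move=> /(_ measurableT _ (measurable_itv `]-oo, M[)); rewrite setTI.
  - by rewrite -[X in measurable X]setTI; exact: mW.
  move=> om /=; rewrite in_itv/= => xM; apply: hN => /= /(_ I) [].
  move=> /eqP; rewrite subr_eq0 => /eqP; rewrite /drop_factor => /esym/(congr1 GRing.inv).
  rewrite invrK invr1 => e.
  have cM : clip M (W om) 0 = M by lra.
  move: cM; rewrite /clip min_r ?ltW// maxEle; have M0 := M_gt0.
  by case: ifP => _ e'; lra.
have nuC : nu (~` [set M]) = 0%E.
  apply/eqP; rewrite eq_le measure_ge0 andbT.
  apply: (@le_trans _ _ (nu (`]-oo, M[%classic `|` ~` `[0, M]%classic))).
    apply: le_measure; rewrite ?inE.
    - exact: measurableC.
    - by apply: measurableU; [exact: measurable_itv|exact: measurableC].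
    move=> y /= yM; rewrite !in_itv/=.
    have [yl|yl] := ltP y M; [by left|right].
    apply/negP; rewrite negb_and -!ltNge; apply/orP; right.
    by rewrite lt_neqAle eq_sym yl andbT; apply/eqP.
  apply: (@le_trans _ _ (nu `]-oo, M[%classic + nu (~` `[0%R, M]%classic))%E).
    by apply: measureU2; [exact: measurable_itv|exact: measurableC].
  by rewrite nuM nu_out adde0.
move=> A mA; rewrite diracE.
have [MA|MA] := boolP (M \in A).
  have AC : nu (~` A) = 0%E.
    apply/eqP; rewrite eq_le measure_ge0 andbT -nuC le_measure ?inE//.
    - exact: measurableC.
    - exact: measurableC.
    - by move=> y /= Ay yM; apply: Ay; rewrite yM -in_setE.
  rewrite -(setCK A) -[LHS]/(nu (~` ~` A)).
  by rewrite [LHS]probability_setC ?AC ?sube0//; exact: measurableC.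
apply/eqP; rewrite eq_le measure_ge0 andbT -[leRHS]/(0%E : \bar R) -nuC.
apply: le_measure; rewrite ?inE//; first exact: measurableC.
by move=> y /= Ay yM; move: MA; rewrite notin_setE -yM.
Qed.

Lemma mean_speed_inv_integral :
  mean_speed_inv M P = (\int[mu]_om crossing_mean M 0 (W om))%E.
Proof.
rewrite /mean_speed_inv [LHS](ge0_integral_distribution WX)//.
- exact: measurable_crossing_mean.
- exact: crossing_mean_ge0.
Qed.

Let es := (\int[mu]_om crossing_mean M 0 (W om))%E.

Lemma integral_crossing_mean_itv : (0 < es < +oo)%E.
Proof.
rewrite /es -mean_speed_inv_integral.
rewrite (mean_speed_inv_gt0 M_gt0 iidP)/=.
exact: (mean_speed_inv_lty M_gt0 iidP rho_drop rho_lt1).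
Qed.

Let ae_pull (A : env R -> Prop) : (\forall x \ae P, A x) -> \forall om \ae mu, A (W om).
Proof.
move=> [N [mN PN hN]]; exists (W @^-1` N); split=> //.
  by rewrite -[X in measurable X]setTI; exact: mW.
by move=> om /= hA; exact: hN.
Qed.

(** These deterministic properties of one environment are all that the quenched argument uses, so a
    single null set serves every starting point and every realization of the chain. *)
Lemma ae_good_env : \forall om \ae mu, [/\ forall i, 0 <= W om i <= M,
  exists C, forall L i, green_sum M (W om) L i ^+ 12 <= C * (1 + `|i|%N%:R) ^+ 2 &
  (\sum_(j < n) site_time M (W om) j%:Z) / n%:R @[n --> \oo] --> fine es].
Proof.
have g1 := ae_pull (ae_green_sum_growth M_gt0 iidP rho_drop rho_lt1).
have g2 := ae_pull (ae_crossing_total_cvg M_gt0 iidP rho_drop rho_lt1).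
move: ae_env_itv g1 g2; apply: filterS3 => om W_itv [C].
rewrite clip_id// => hC; rewrite mean_speed_inv_integral => hs; split=> //.
  by exists C.
suff E j : crossing_time M j (W om) = site_time M (W om) j.
  move: hs; rewrite /crossing_total.
  by under eq_fun do under eq_bigr do rewrite E.
rewrite /crossing_time /crossing_mean /site_time.
have -> : (fun L => (crossing_sum M L j (W om))%:E) =
   EFin \o (fun L => lambda M * (beta M (W om) j * green_sum M (W om) L j)).
  by apply/funext => L; rewrite /crossing_sum clip_id.
have cv : lambda M * (beta M (W om) j * green_sum M (W om) L j) @[L --> \oo] -->
    lambda M * (beta M (W om) j * green M (W om) j).
  apply: cvgM; first exact: cvg_cst.
  by apply: cvgM; [exact: cvg_cst|exact: (green_cvg W_itv hC)].
by rewrite EFin_lim; [rewrite (cvg_lim _ cv)|exact: cvgP cv].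
Qed.

End IidEnvironment.

Lemma markov_chain_reflect d (T : measurableType d) (R : realType)
    (Q : probability T R) (M : R) w kappa k X :
  markov_chain Q (trans M w kappa) k X ->
  markov_chain Q (trans M (reflect_env w) (1 - kappa)) (- k) (fun n t => - X n t).
Proof.
move=> [mX X0 hX].
have E n i : (fun t => - X n t) @^-1` [set i] = X n @^-1` [set - i].
  by apply/seteqP; split=> t /= h; lia.
split.
- by move=> n i; rewrite E.
- by rewrite E opprK.
move=> n x; have := hX n (fun m => - x m).
rewrite -(trans_reflect M w kappa) !opprK.
have F n' : [set t | forall m, (m <= n')%N -> X m t = - x m] =
    [set t | forall m, (m <= n')%N -> - X m t = x m].
  by apply/seteqP; split=> t /= h m mn; have := h m mn; lia.
by rewrite !F.
Qed.

Lemma iid_env_of_iid d (Omega : measurableType d) (R : realType)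
    (mu : probability Omega R) (nu : probability R R) (w : int -> {RV mu >-> R}) :
  iid_with_law nu w -> iid_env nu mu (fun om i => w i om).
Proof.
move=> [ind law].
have mW : measurable_fun setT ((fun om i => w i om) : Omega -> env R).
  by apply: measurable_env => i; exact: measurable_funP.
split=> // s A us mA; have := ind s A us mA.
rewrite (eq_bigr (fun i => fine (nu (A i)))) => [<-|i _]; last by rewrite -(law i _ (mA i)).
rewrite fineK// fin_num_measure//.
have := mW measurableT (cylinder s A); rewrite setTI; apply.
by apply: sub_sigma_algebra; exists s, A.
Qed.

Theorem theorem3p5 (R : realType) (M : R) (nu : probability R R)
    (d : measure_display) (Omega : measurableType d) (mu : probability Omega R)
    (w : int -> {RV mu >-> R}) (kappa : R)
    (hM : 0 < M)
    (hnu_supp : nu `[0, M]%classic = 1%E)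
    (hnu_dirac : ~ (forall A : set R, measurable A -> nu A = \d_M A))
    (hnu_max : forall eps : R, 0 < eps -> (0 < nu `[(M - eps)%R, M]%classic)%E)
    (hw : iid_with_law nu w)
    (hkappa0 : 0 < kappa) (hkappa1 : kappa < 1) :
  let ES : \bar R := (\int[mu]_om speed_sum M (fun i => w i om))%E in
  let v : R := (fine ES)^-1 in
  (0 < ES < +oo)%E /\
  \forall om \ae mu,
    forall (k : int) (d' : measure_display) (T : measurableType d')
           (Q : probability T R) (X : nat -> T -> int),
      markov_chain Q (trans M (fun i => w i om) kappa) k X ->
      [/\ (Q (to_pinfty R X) + Q (to_ninfty R X) = 1)%E,
          \forall t \ae Q, to_pinfty R X t ->
            (X n t)%:~R / n%:R @[n --> \oo] --> v &
          \forall t \ae Q, to_ninfty R X t ->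
            (X n t)%:~R / n%:R @[n --> \oo] --> - v].
Proof.
move=> ES v.
have iidW := iid_env_of_iid hw.
set W : Omega -> env R := fun om i => w i om in iidW.
have iidW' := iid_env_inj (@opprK int) iidW.
set W' : Omega -> env R := fun om i => W om (- i) in iidW'.
have ESE : ES = (\int[mu]_om crossing_mean M 0 (W om))%E.
  have [N [mN muN hN]] := ae_env_itv hnu_supp iidW.
  apply: (integral_off_null mN muN) => om Nom.
  apply: speed_sum_crossing_mean => //; apply: contrapT => h; apply: Nom.
  exact: hN.
(* The reflected environment has the same law, so both ends share the same mean crossing time and
   the two speeds are opposite. *)
have ESE' : ES = (\int[mu]_om crossing_mean M 0 (W' om))%E.
  rewrite ESE; apply: (iid_env_integral iidW iidW').
    exact: measurable_crossing_mean.
  exact: crossing_mean_ge0.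
have ES_itv : (0 < ES < +oo)%E.
  by rewrite ESE; exact: (integral_crossing_mean_itv hM hnu_supp hnu_dirac iidW).
split=> //.
have es0 : 0 < fine ES by apply: fine_gt0.
have := ae_good_env hM hnu_supp hnu_dirac iidW.
have := ae_good_env hM hnu_supp hnu_dirac iidW'.
rewrite -ESE -ESE'; apply: filterS2 => om [itv' [C' gr'] sl'] [itv [C gr] sl].
move=> k d' T Q X chainX; split.
- exact: (escape_total itv hkappa0 hkappa1 gr chainX).
- exact: (ae_speed itv hkappa0 hkappa1 gr chainX es0 sl).
have k0' : 0 < 1 - kappa by rewrite subr_gt0.
have k1' : 1 - kappa < 1 by rewrite gtrBl.
have := ae_speed itv' k0' k1' gr' (markov_chain_reflect chainX) es0 sl'.
apply: filterS => t h /int_cvg_ninftyP Xn; have := h Xn => hX.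
have -> : (fun n => (X n t)%:~R / n%:R : R) = (fun n => - ((- X n t)%:~R / n%:R)).
  by apply/funext => n; rewrite mulrNz mulNr opprK.
exact: cvgN.
Qed.
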